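(* Let $d\ge 3$, let $P$ be a simple $d$-dimensional polytope (irredundant rational inequality description) with vertices $\mathbf{u}\ne\mathbf{v}$, and let $r$ be an integer with $r\ge\max(\mathrm{diam}(P),6)$. Let $Q=C^r(C^r(P,\mathbf{u}),\mathbf{v})$ be the result of applying $r$-cyclic siloing at $\mathbf{u}$ and then at $\mathbf{v}$ (for any choices of the initial neighbor enumerations). Then $\mathrm{diam}(Q)=d_P(\mathbf{u},\mathbf{v})+2rd(d-1)$.
   Context: $\mathrm{diam}$ is the diameter of the vertex–edge graph and $d_P$ graph distance in $P$. A $d$-polytope is simple if each vertex satisfies exactly $d$ defining inequalities with equality (its feasible basis). Truncation $T(P,\mathbf{w})$: for a vertex $\mathbf{w}$ with neighbors $\mathbf{w}_1,\dots,\mathbf{w}_d$, add one new inequality whose bounding hyperplane passes through the midpoints $\frac{\mathbf{w}+\mathbf{w}_i}{2}$ and which is violated by $\mathbf{w}$ (all other vertices remain vertices). Silo $S(P,\mathbf{w},\prec)$ for a linear order $b_1\prec\dots\prec b_d$ on the feasible basis of $\mathbf{w}$: $T^0=P$; for $k=0,\dots,d-1$, $T^{k+1}=T(T^k,\mathbf{w}^k)$ where $\mathbf{w}^k$ is the vertex of $T^k$ with feasible basis $\{b_{k+1},\dots,b_d\}\cup\{t_1,\dots,t_k\}$ and $t_{k+1}$ is the inequality added; $S(P,\mathbf{w},\prec)=T^d$, with peak the vertex of feasible basis $\{t_1,\dots,t_d\}$. Let $\phi$ map $(a,b)\in[d]^2$, $a\ne b$, to the silo vertex with feasible basis $\{b_i: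 i\in[d]\setminus([b-1]\cup\{a\})\}\cup\{t_1,\dots,t_b\}$ if $a>b$, and $\{b_i:i\in[d]\setminus[b-1]\}\cup\{t_i:i\in[b]\setminus\{a\}\}$ if $a<b$. For $z\in\mathbb{Z}$, $\overline{z}\in[d]$ is the element congruent to $z$ mod $d$. $r$-cyclic siloing $C^r(P,\mathbf{w})$: $C_0=P$, $\mathbf{w}_0=\mathbf{w}$, $\mathbf{w}_{1,0},\dots,\mathbf{w}_{d,0}$ an arbitrary enumeration of the neighbors of $\mathbf{w}$. For $j=1,\dots,rd$: label the feasible basis of $\mathbf{w}_{j-1}$ in $C_{j-1}$ as $b_{1,j-1},\dots,b_{d,j-1}$ so that the inequalities tight at both $\mathbf{w}_{j-1}$ and $\mathbf{w}_{i,j-1}$ are exactly those other than $b_{i,j-1}$; let $\prec_{j-1}$ be $b_{\overline{j},j-1}\prec b_{\overline{j+1},j-1}\prec\dots\prec b_{\overline{j+d-1},j-1}$; $C_j=S(C_{j-1},\mathbf{w}_{j-1},\prec_{j-1})$, $\mathbf{w}_j$ its peak, $\phi_j$ the map $\phi$ for this silo, $\mathbf{w}_{i,j}=\phi_j(\overline{i-j+1},d)$ for $i\ne\overline{j-1}$ and $\mathbf{w}_{\overline{j-1},j}=\phi_j(d,d-1)$. Then $C^r(P,\mathbf{w}):=C_{rd}$. (Since $\mathbf{u}\ne\mathbf{v}$, $\mathbf{v}$ is still a vertex of $C^r(P,\mathbf{u})$.) *)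

(* Defs.v *)
From mathcomp Require Import all_boot all_order all_algebra.
From mathcomp Require Import boolp classical_sets reals.

Set Implicit Arguments.
Unset Strict Implicit.
Unset Printing Implicit Defensive.

Import Order.TTheory GRing.Theory Num.Theory.
Local Open Scope ring_scope.

Definition dot (R : realType) (d : nat) (a x : 'rV[R]_d) : R :=
  \sum_(i < d) a 0 i * x 0 i.

(* The pair (a, b) encodes the inequality a . x <= b; a polyhedron is given by
   its list of defining inequalities. *)
Notation ineq R d := ('rV[R]_d * R)%type.
Notation hdesc R d := (seq (ineq R d)).

Definition sat (R : realType) (d : nat) (c : ineq R d) (x : 'rV[R]_d) : bool :=
  dot c.1 x <= c.2.

Definition tight (R : realType) (d : nat) (c : ineq R d) (x : 'rV[R]_d) : bool :=
  dot c.1 x == c.2.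

Definition feasible (R : realType) (d : nat) (P : hdesc R d) (x : 'rV[R]_d)
    : bool :=
  all (fun c => sat c x) P.

Definition rational_desc (R : realType) (d : nat) (P : hdesc R d) : Prop :=
  forall c : ineq R d, c \in P ->
    (forall i, exists q : rat, c.1 0 i = ratr q) /\
    (exists q : rat, c.2 = ratr q).

Definition irredundant (R : realType) (d : nat) (P : hdesc R d) : Prop :=
  forall c : ineq R d, c \in P ->
    exists x : 'rV[R]_d, feasible (rem c P) x /\ ~~ feasible P x.

Definition bounded_desc (R : realType) (d : nat) (P : hdesc R d) : Prop :=
  exists M : R, forall x, feasible P x -> forall i, `|x 0 i| <= M.

(* d + 1 affinely independent points of P *)
Definition full_dimensional (R : realType) (d : nat) (P : hdesc R d) : Prop :=
  exists x : 'I_d.+1 -> 'rV[R]_d,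
    (forall i, feasible P (x i)) /\
    row_free (\matrix_(i < d) (x (lift ord0 i) - x ord0)).

Definition polytope (R : realType) (d : nat) (P : hdesc R d) : Prop :=
  bounded_desc P /\ full_dimensional P.

(* The face of P on which the linear functional c is maximal *)
Definition max_face (R : realType) (d : nat) (P : hdesc R d)
    (c x : 'rV[R]_d) : Prop :=
  feasible P x /\ forall y, feasible P y -> dot c y <= dot c x.

Definition vertex (R : realType) (d : nat) (P : hdesc R d) (x : 'rV[R]_d)
    : Prop :=
  exists c, forall y, max_face P c y <-> y = x.

Definition on_segment (R : realType) (d : nat) (x y z : 'rV[R]_d) : Prop :=
  exists t : R, 0 <= t <= 1 /\ z = (1 - t) *: x + t *: y.

Definition adjacent (R : realType) (d : nat) (P : hdesc R d) (x y : 'rV[R]_d)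
    : Prop :=
  [/\ vertex P x, vertex P y, x <> y &
      exists c, forall z, max_face P c z <-> on_segment x y z].

Fixpoint walk (R : realType) (d : nat) (P : hdesc R d) (n : nat)
    (x y : 'rV[R]_d) : Prop :=
  if n is n'.+1 then exists z, adjacent P x z /\ walk P n' z y else x = y.

Definition is_dist (R : realType) (d : nat) (P : hdesc R d) (x y : 'rV[R]_d)
    (n : nat) : Prop :=
  walk P n x y /\ forall m, walk P m x y -> (n <= m)%N.

Definition is_diam (R : realType) (d : nat) (P : hdesc R d) (n : nat) : Prop :=
  (forall x y, vertex P x -> vertex P y ->
     exists m, is_dist P x y m /\ (m <= n)%N) /\
  (exists x y, [/\ vertex P x, vertex P y & is_dist P x y n]).

(* The unique n satisfying the predicate; 0 if there is none. *)
Definition dist (R : realType) (d : nat) (P : hdesc R d) (x y : 'rV[R]_d)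
    : nat :=
  xget 0%N (is_dist P x y).

Definition diam (R : realType) (d : nat) (P : hdesc R d) : nat :=
  xget 0%N (is_diam P).

Definition tight_ineqs (R : realType) (d : nat) (P : hdesc R d)
    (x : 'rV[R]_d) : seq (ineq R d) :=
  [seq c <- P | tight c x].

Definition simple (R : realType) (d : nat) (P : hdesc R d) : Prop :=
  forall x, vertex P x -> size (tight_ineqs P x) = d.

Definition vertex_with_basis (R : realType) (d : nat) (P : hdesc R d)
    (B : seq (ineq R d)) (x : 'rV[R]_d) : Prop :=
  vertex P x /\ tight_ineqs P x =i B.

(* t may be added to P to form T(P, w); this determines t up to a positive
   factor. *)
Definition truncating (R : realType) (d : nat) (P : hdesc R d)
    (w : 'rV[R]_d) (t : ineq R d) : Prop :=
  [/\ vertex P w,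
      forall w', adjacent P w w' -> tight t (2^-1 *: (w + w')) &
      ~~ sat t w].

(* Families indexed by [d] = {1, ..., d} are functions on nat, of which only
   the values at 1, ..., d are used. *)

Definition add_ineqs (R : realType) (d : nat) (P : hdesc R d)
    (t : nat -> ineq R d) (k : nat) : hdesc R d :=
  P ++ [seq t i | i <- iota 1 k].

(* t 1, ..., t d are the inequalities added in the construction of the silo
   S(P, w, <) for the order b 1 < ... < b d, so that T^k = add_ineqs P t k. *)
Definition siloing (R : realType) (d : nat) (P : hdesc R d) (w : 'rV[R]_d)
    (b t : nat -> ineq R d) : Prop :=
  [/\ uniq [seq b i | i <- iota 1 d],
      vertex_with_basis P [seq b i | i <- iota 1 d] w &
      forall k, (k < d)%N ->
        exists wk : 'rV[R]_d,
          vertex_with_basis (add_ineqs P t k)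
            ([seq b i | i <- iota 1 d & (k < i)%N] ++
             [seq t i | i <- iota 1 k]) wk /\
          truncating (add_ineqs P t k) wk (t k.+1)].

Definition is_peak (R : realType) (d : nat) (P : hdesc R d)
    (t : nat -> ineq R d) (x : 'rV[R]_d) : Prop :=
  vertex_with_basis (add_ineqs P t d) [seq t i | i <- iota 1 d] x.

(* Feasible basis of phi (a, e), for a <> e *)
Definition phi_basis (R : realType) (d : nat) (b t : nat -> ineq R d)
    (a e : nat) : seq (ineq R d) :=
  if (e < a)%N then
    [seq b i | i <- iota 1 d & (e <= i)%N && (i != a)] ++
    [seq t i | i <- iota 1 e]
  else
    [seq b i | i <- iota 1 d & (e <= i)%N] ++
    [seq t i | i <- iota 1 e & i != a].

Definition is_phi (R : realType) (d : nat) (P : hdesc R d)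
    (b t : nat -> ineq R d) (a e : nat) (x : 'rV[R]_d) : Prop :=
  vertex_with_basis (add_ineqs P t d) (phi_basis b t a e) x.

(* The element of {1, ..., d} congruent to z modulo d (d > 0) *)
Definition cyc (d : nat) (z : int) : nat := `|((z - 1) %% d)%Z|%N.+1.

(* The step from (C_{j-1}, w_{j-1}, w_{.,j-1}) to (C_j, w_j, w_{.,j}); here b
   is the labelling b_{.,j-1} and b' its reindexing along the order. *)
Definition cyclic_step (R : realType) (d j : nat)
    (C : hdesc R d) (w : 'rV[R]_d) (nb : nat -> 'rV[R]_d)
    (C' : hdesc R d) (w' : 'rV[R]_d) (nb' : nat -> 'rV[R]_d) : Prop :=
  exists b t : nat -> ineq R d,
    let b' := fun k : nat => b (cyc d (j%:Z + k%:Z - 1)) in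
    [/\ tight_ineqs C w =i [seq b i | i <- iota 1 d],
        forall i, (1 <= i <= d)%N ->
          [seq c <- C | tight c w && tight c (nb i)] =i
          [seq c <- tight_ineqs C w | c != b i],
        siloing C w b' t,
        C' = add_ineqs C t d /\ is_peak C t w' &
        forall i, (1 <= i <= d)%N ->
          if i == cyc d (j%:Z - 1) then is_phi C b' t d d.-1 (nb' i)
          else is_phi C b' t (cyc d (i%:Z - j%:Z + 1)) d (nb' i)].

Definition enumerates_neighbors (R : realType) (d : nat) (P : hdesc R d)
    (w : 'rV[R]_d) (nb : nat -> 'rV[R]_d) : Prop :=
  uniq [seq nb i | i <- iota 1 d] /\
  forall x, adjacent P w x <-> x \in [seq nb i | i <- iota 1 d].

(* Q is C^r(P, w), constructed from the initial enumeration nb. *)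
Definition cyclic_siloing (R : realType) (d r : nat) (P : hdesc R d)
    (w : 'rV[R]_d) (nb : nat -> 'rV[R]_d) (Q : hdesc R d) : Prop :=
  exists (C : nat -> hdesc R d) (ws : nat -> 'rV[R]_d)
         (nbs : nat -> nat -> 'rV[R]_d),
    [/\ [/\ C 0%N = P, ws 0%N = w & nbs 0%N = nb],
        vertex P w /\ enumerates_neighbors P w nb,
        forall j, (1 <= j <= r * d)%N ->
          cyclic_step j (C j.-1) (ws j.-1) (nbs j.-1) (C j) (ws j) (nbs j) &
        Q = C (r * d)%N].

(* Main.v *)
(* Truncating a vertex of a simple polytope replaces it by a clique, one new
   vertex on each of its d edges, so all graphs can be read off from tight sets.
   The graph of a silo consists of d columns, one above each neighbor of
   w, all ending at the peak; the height of a silo vertex is the number of tight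
   new inequalities, the neighbors of the peak have height d - 1, and an edge
   changes the height by at most one.  Contracting the silo to w does not
   lengthen walks either, hence siloing increases the distance to the chosen
   vertex by exactly d - 1, and stacking rd silos on u and on v puts the two
   peaks at distance d_P(u, v) + 2 K, where K = rd(d - 1).

   Conversely, in one silo the columns at positions k and k' are joined by an
   edge between vertices of equal height unless {k, k'} = {1, d}.  The cyclic
   shift of the positions makes this exception disappear in the next silo, so a
   walk down the stack may change column at the cost of a single step.  Hence
   every vertex of a stack is within K + 1 of every neighbor of the original
   vertex, and no pair of vertices is farther apart than the two peaks; the
   condition r >= max(diam P, 6) takes care of all pairs that are not in
   different stacks. *)
Require Import Defs.
From mathcomp Require Import all_boot all_order all_algebra.
From mathcomp Require Import boolp classical_sets reals.
From mathcomp Require Import zify ring lra.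

Set Implicit Arguments.
Unset Strict Implicit.
Unset Printing Implicit Defensive.

Import Order.TTheory GRing.Theory Num.Theory.
Local Open Scope ring_scope.

(** * Vertices and edges of polyhedra *)

Section Geometry.
Variables (R : realType) (d : nat).
Implicit Types (P L : hdesc R d) (c t : ineq R d) (x y z w p : 'rV[R]_d).

Lemma dotDr (a x y : 'rV[R]_d) : dot a (x + y) = dot a x + dot a y.
Proof.
by rewrite /dot -big_split; apply: eq_bigr => i _; rewrite mxE mulrDr.
Qed.

Lemma dotZr (k : R) (a x : 'rV[R]_d) : dot a (k *: x) = k * dot a x.
Proof.
by rewrite /dot mulr_sumr; apply: eq_bigr => i _; rewrite mxE mulrCA.
Qed.

Lemma dotNr (a x : 'rV[R]_d) : dot a (- x) = - dot a x.
Proof. by rewrite -scaleN1r dotZr mulN1r. Qed.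

Lemma dotBr (a x y : 'rV[R]_d) : dot a (x - y) = dot a x - dot a y.
Proof. by rewrite dotDr dotNr. Qed.

Lemma dot0r (a : 'rV[R]_d) : dot a 0 = 0.
Proof. by rewrite -(scale0r 0) dotZr mul0r. Qed.

Lemma dotC (a x : 'rV[R]_d) : dot a x = dot x a.
Proof. by apply: eq_bigr => i _; rewrite mulrC. Qed.

Lemma dot_sumr (I : Type) (s : seq I) (F : I -> 'rV[R]_d) (a : 'rV[R]_d) :
  dot a (\sum_(i <- s) F i) = \sum_(i <- s) dot a (F i).
Proof.
elim: s => [|i s IH]; first by rewrite !big_nil dot0r.
by rewrite !big_cons dotDr IH.
Qed.

Definition dotE := (dotDr, dotBr, dotZr, dotNr, dot0r).

Lemma dot_self_eq0 z : dot z z = 0 -> z = 0.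
Proof.
move/eqP; rewrite /dot psumr_eq0 => [/allP h|i _]; last exact: sqr_ge0.
apply/rowP => i; rewrite mxE; apply/eqP.
by have := h i (mem_index_enum _); rewrite /= mulf_eq0 orbb.
Qed.

(** Says that the normals of [L] span the whole space, through the triviality of their orthogonal
    complement, the form in which it is used. *)
Definition spans L := forall z, (forall c, c \in L -> dot c.1 z = 0) -> z = 0.

Lemma exists_orthogonal L :
  (size L < d)%N -> exists2 z, z != 0 & forall c, c \in L -> dot c.1 z = 0.
Proof.
move=> ltLd; pose A : 'M[R]_(d, size L) := \matrix_(i, j) (tnth (in_tuple L) j).1 0 i.
have kn0 : kermx A != 0.
  rewrite -mxrank_eq0 mxrank_ker subn_eq0 -ltnNge.
  exact: leq_ltn_trans (rank_leq_col A) ltLd.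
have [i rn0] : exists i, row i (kermx A) != 0.
  apply/existsP; apply: contraNT kn0; rewrite negb_exists => /forallP h.
  apply/eqP/row_matrixP => i; rewrite row0; apply/eqP.
  by have := h i; rewrite negbK.
exists (row i (kermx A)) => // c cL.
have : row i (kermx A) *m A = 0 by rewrite -row_mul mulmx_ker row0.
move=> /rowP /(_ (Ordinal (etrans (index_mem c L) cL))).
rewrite !mxE => <-; rewrite dotC; apply: eq_bigr => k _.
by rewrite !mxE (tnth_nth c) /= nth_index.
Qed.

(** The other $d-1$ normals leave a nonzero orthogonal direction, on which [c] cannot vanish by
    spanning. The value $-1$ makes it point into the half-space of [c], hence along the edge that
    leaves [c]. *)
Lemma dual_vector L c : spans L -> size L = d -> c \in L ->
  exists2 z, dot c.1 z = -1 & forall c', c' \in rem c L -> dot c'.1 z = 0.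
Proof.
move=> sL szL cL.
have [|z zn0 hz] := @exists_orthogonal (rem c L).
  rewrite size_rem // szL ltn_predL; move: (congr1 (leq 1) szL) => <-.
  by case: (L) cL.
have cz : dot c.1 z != 0.
  apply: contraNneq zn0 => cz0; apply/eqP/sL => c' c'L.
  by have [->//|nc] := eqVneq c' c; apply: hz; apply: rem_mem.
exists (- (dot c.1 z)^-1 *: z); first by rewrite dotZr mulNr mulVf.
by move=> c' /hz hc'; rewrite dotZr hc' mulr0.
Qed.

(** A repeated [c] would survive in [rem c L], and its dual vector would have product both $-1$ and
    $0$ with it. *)
Lemma spans_uniq L : spans L -> size L = d -> uniq L.
Proof.
move=> sL szL; have h c : c \in L -> c \notin rem c L.
  move=> cL; have [z cz hz] := dual_vector sL szL cL.
  by apply/negP => /hz; rewrite cz; lra.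
apply: count_mem_uniq => c; have [cL|/count_memPn//] := boolP (c \in L).
rewrite (permP (perm_to_rem cL)) /= eqxx.
by have /count_memPn -> := h c cL.
Qed.

(** * Feasible directions and vertices *)

Lemma feasibleP P x :
  reflect (forall c, c \in P -> dot c.1 x <= c.2) (feasible P x).
Proof. exact: allP. Qed.

Lemma mem_tight P x c : (c \in tight_ineqs P x) = tight c x && (c \in P).
Proof. by rewrite mem_filter. Qed.

Lemma feasible_perturb P x z : feasible P x ->
  (forall c, c \in P -> tight c x -> dot c.1 z <= 0) ->
  exists2 e : R, 0 < e &
    forall e', 0 <= e' <= e -> feasible P (x + e' *: z).
Proof.
elim: P => [|c P IH] /=; first by exists 1.
move=> /andP[cx Px] h.
have [|e e0 he] := IH Px; first by move=> c' c'P; apply: h; rewrite inE c'P orbT.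
have [f f0 hf] : exists2 f : R, 0 < f & forall f', 0 <= f' <= f -> sat c (x + f' *: z).
  have [cz|cz] := leP (dot c.1 z) 0.
    exists 1 => // f' /andP[f'0 _]; move: cx; rewrite /sat !dotE => cx; nra.
  have ntx : dot c.1 x < c.2.
    move: cx; rewrite /sat le_eqVlt => /predU1P[/eqP tx|//].
    by have := h c (mem_head _ _) tx; lra.
  exists ((c.2 - dot c.1 x) / dot c.1 z); first by rewrite divr_gt0 // subr_gt0.
  move=> f' /andP[_]; rewrite ler_pdivlMr // /sat !dotE; lra.
exists (Num.min e f); first by rewrite lt_min e0.
move=> e'; rewrite le_min => /and3P[e'0 e'e e'f].
by rewrite hf ?e'0 //= he ?e'0.
Qed.

(** Equality in a sum of inequalities forces equality in each. This makes the sum of a list of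
    normals the functional exposing the face on which they are tight. *)
Lemma sum_tight L x y : (forall c, c \in L -> dot c.1 y <= c.2) ->
  (forall c, c \in L -> tight c x) ->
  dot (\sum_(c <- L) c.1) x <= dot (\sum_(c <- L) c.1) y ->
  forall c, c \in L -> tight c y.
Proof.
rewrite ![dot (\sum_(c <- L) _) _]dotC !dot_sumr.
elim: L => // c L IH hy hx.
have cy := hy c (mem_head _ _); have /eqP cx := hx c (mem_head _ _).
have hyL c' : c' \in L -> dot c'.1 y <= c'.2.
  by move=> c'L; apply: hy; rewrite inE c'L orbT.
have hxL c' : c' \in L -> tight c' x.
  by move=> c'L; apply: hx; rewrite inE c'L orbT.
have le : \sum_(c <- L) dot y c.1 <= \sum_(c <- L) dot x c.1.
  rewrite big_seq [leRHS]big_seq; apply: ler_sum => c' c'L.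
  by rewrite dotC (dotC x) (eqP (hxL _ c'L)) hyL.
rewrite !big_cons => h c'; rewrite inE => /predU1P[->|]; last first.
  by apply: (IH hyL hxL); move: h; rewrite dotC (dotC y) cx; lra.
by apply/eqP; move: h; rewrite dotC (dotC y) cx; lra.
Qed.

Lemma tight_sum_max L P x : {subset L <= P} ->
  (forall c, c \in L -> tight c x) ->
  forall y, feasible P y ->
    dot (\sum_(c <- L) c.1) y <= dot (\sum_(c <- L) c.1) x.
Proof.
move=> LP hx y /feasibleP hy; rewrite dotC [leRHS]dotC !dot_sumr.
rewrite big_seq [leRHS]big_seq; apply: ler_sum => c cL.
by rewrite dotC (dotC x) (eqP (hx c cL)) hy // LP.
Qed.

(** The sum of the tight normals exposes [x] when they span. Conversely, a direction orthogonal to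
    all of them can be followed both ways, so the exposing functional is constant along it and
    uniqueness of the maximum makes it zero. *)
Lemma vertexP P x :
  vertex P x <-> feasible P x /\ spans (tight_ineqs P x).
Proof.
split=> [[g hg]|[Px sx]]; last first.
  exists (\sum_(c <- tight_ineqs P x) c.1) => y.
  have sub : {subset tight_ineqs P x <= P} by apply: mem_subseq (filter_subseq _ _).
  have tx c : c \in tight_ineqs P x -> tight c x by rewrite mem_tight => /andP[].
  split=> [[/feasibleP Py hy]|->]; last first.
    by split=> //; apply: tight_sum_max sub tx.
  have ty : forall c, c \in tight_ineqs P x -> tight c y.
    apply: sum_tight tx _; last exact: hy.
    by move=> c /sub /Py.
  apply/eqP; rewrite -subr_eq0; apply/eqP/sx => c cT.
  by rewrite dotBr (eqP (ty c cT)) (eqP (tx c cT)) subrr.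
have [Px mx] : max_face P g x by apply/hg.
split=> // z hz.
have hz' c : c \in P -> tight c x -> dot c.1 z = 0.
  by move=> cP tc; apply: hz; rewrite mem_tight tc.
have [|e e0 he] := @feasible_perturb P x z Px; first by move=> c cP tc; rewrite hz'.
have [|f f0 hf] := @feasible_perturb P x (- z) Px.
  by move=> c cP tc; rewrite dotNr hz' // oppr0.
have Pe : feasible P (x + e *: z) by apply: he; lra.
have Pf : feasible P (x + f *: - z) by apply: hf; lra.
have gz : dot g z = 0.
  have := mx _ Pe; have := mx _ Pf; rewrite !dotE; nra.
have : max_face P g (x + e *: z).
  by split=> // y /mx; rewrite !dotE gz mulr0 addr0.
move/hg/eqP; rewrite -subr_eq0 addrAC subrr add0r scaler_eq0 gt_eqF //=.
by move/eqP.
Qed.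

Lemma vertex_feasible P x : vertex P x -> feasible P x.
Proof. by move/vertexP => []. Qed.

Lemma vertex_determined P x y : vertex P x ->
  (forall c, c \in P -> tight c x -> tight c y) -> y = x.
Proof.
move=> /vertexP[_ sx] h; apply/eqP; rewrite -subr_eq0; apply/eqP/sx => c.
rewrite mem_tight => /andP[tx cP].
by rewrite dotBr (eqP (h c cP tx)) (eqP tx) subrr.
Qed.

Lemma exists_seq_min (T : eqType) (s : seq T) (f : T -> R) (a : T) :
  a \in s -> exists2 b, b \in s & forall b', b' \in s -> f b <= f b'.
Proof.
elim: s a => // a0 s IH a _; case: s IH => [_|a1 s /(_ a1 (mem_head _ _)) [b bs hb]].
  by exists a0; rewrite ?mem_head // => b'; rewrite inE => /eqP ->.
have [le|lt] := leP (f a0) (f b).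
  exists a0; first exact: mem_head.
  move=> b'; rewrite inE => /predU1P[->//|/hb]; exact: le_trans.
exists b; first by rewrite inE bs orbT.
by move=> b'; rewrite inE => /predU1P[->|/hb //]; apply: ltW.
Qed.

(** The ratio test of the simplex method: boundedness provides an inequality that increases along
    [z], and the smallest ratio of slack to slope is the step length. *)
Lemma exit_point P x z : bounded_desc P -> feasible P x -> z != 0 ->
  (forall c, c \in P -> tight c x -> dot c.1 z <= 0) ->
  exists s : R, [/\ 0 < s, feasible P (x + s *: z) &
    exists c, [/\ c \in P, tight c (x + s *: z) & 0 < dot c.1 z]].
Proof.
move=> [M hM] Px zn0 hz.
have /feasibleP Px' := Px.
pose L := [seq c <- P | 0 < dot c.1 z].
have [c0 c0L] : exists c, c \in L.
  case EL : L => [|c L']; last by exists c; rewrite mem_head.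
  have np c : c \in P -> dot c.1 z <= 0.
    move=> cP; rewrite leNgt; apply/negP => h.
    by have := EL; have : c \in L by [rewrite mem_filter h]; move=> /[swap] ->.
  have [i zi] : exists i, z 0 i != 0.
    apply/existsP; apply: contraNT zn0; rewrite negb_exists => /forallP h.
    by apply/eqP/rowP => i; rewrite mxE; apply/eqP; have := h i; rewrite negbK.
  (* This step moves coordinate [i] by $|M|+|x_i|+1$, which takes it out of the bounding box. *)
  pose s := (`|M| + `|x 0 i| + 1) / `|z 0 i|.
  have s0 : 0 <= s by rewrite divr_ge0 // !addr_ge0.
  have /hM /(_ i) : feasible P (x + s *: z).
    apply/feasibleP => c cP; rewrite !dotE.
    by have := np c cP; have := Px' c cP; nra.
  rewrite !mxE => h; exfalso.
  have : `|s * z 0 i| = `|M| + `|x 0 i| + 1.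
    by rewrite normrM (ger0_norm s0) /s divfK // normr_eq0.
  have := ler_normB (x 0 i + s * z 0 i) (x 0 i).
  rewrite addrAC subrr add0r; have := ler_norm M; lra.
have [c cL hc] := exists_seq_min (fun c => (c.2 - dot c.1 x) / dot c.1 z) c0L.
move: (cL); rewrite mem_filter => /andP[cz cP].
have ntx : dot c.1 x < c.2.
  rewrite lt_neqAle Px' // andbT; apply/negP => tx.
  by have := hz c cP tx; lra.
exists ((c.2 - dot c.1 x) / dot c.1 z); split.
- by rewrite divr_gt0 // subr_gt0.
- apply/feasibleP => c' c'P; rewrite !dotE.
  have [c'z|c'z] := ltP 0 (dot c'.1 z).
    have := hc c'; rewrite mem_filter c'z c'P => /(_ isT).
    by rewrite [X in _ <= X -> _]mulrC ler_pdivlMl // mulrC [X in X <= _ -> _]mulrC; lra.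
  have : 0 <= (c.2 - dot c.1 x) / dot c.1 z by rewrite divr_ge0 // ?ltW // subr_gt0.
  by have := Px' c' c'P; nra.
- exists c; split=> //; rewrite /tight !dotE divfK ?lt0r_neq0 //.
  by rewrite addrC subrK.
Qed.

(** * Segments and edges *)

Lemma on_segment_sym x y z : on_segment x y z <-> on_segment y x z.
Proof.
suff h a b : on_segment a b z -> on_segment b a z by split; apply: h.
move=> [s [/andP[s0 s1] ->]]; exists (1 - s); split; first by apply/andP; split; lra.
by rewrite addrC opprB addrCA subrr addr0.
Qed.

Lemma adjacent_sym P x y : adjacent P x y -> adjacent P y x.
Proof.
move=> [vx vy ne [g hg]]; split=> //; first by move/esym.
by exists g => z; rewrite hg; apply: on_segment_sym.
Qed.

Lemma feasible_segment P x y z :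
  feasible P x -> feasible P y -> on_segment x y z -> feasible P z.
Proof.
move=> /feasibleP Px /feasibleP Py [s [/andP[s0 s1] ->]].
apply/feasibleP => c cP; rewrite !dotE.
by have := Px c cP; have := Py c cP; nra.
Qed.

Lemma tight_between P x y (s : R) : feasible P x -> feasible P y ->
  0 < s < 1 -> forall c, c \in P ->
  tight c ((1 - s) *: x + s *: y) = tight c x && tight c y.
Proof.
move=> /feasibleP Px /feasibleP Py /andP[s0 s1] c cP.
have := Px c cP; have := Py c cP => hy hx.
rewrite /tight !dotE; apply/eqP/andP => [h|[/eqP -> /eqP ->]]; last by ring.
by split; apply/eqP; nra.
Qed.

(* Extending the segment [y x] beyond x leaves the polyhedron: otherwise x
   would lie strictly between two feasible points. *)
Lemma vertex_not_between P x y (a : R) : vertex P x -> feasible P y -> x <> y ->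
  feasible P (x + a *: (y - x)) -> 0 <= a.
Proof.
move=> vx Py ne Pz; rewrite leNgt; apply/negP => a0; apply: ne.
apply/esym/(vertex_determined vx) => c cP tx.
have s1 : 0 < - a / (1 - a) < 1.
  by rewrite divr_gt0 ?ltr_pdivrMr /=; lra.
have xE : x = (1 - (- a / (1 - a))) *: (x + a *: (y - x)) + (- a / (1 - a)) *: y.
  by apply/rowP => i; rewrite !mxE; field; lra.
by move: tx; rewrite {1}xE (tight_between Pz Py s1) // => /andP[].
Qed.

(** The sum of the normals tight at both ends exposes a face which the hypothesis confines to the
    line through [x] and [y]; feasible points of that line cannot pass either vertex. *)
Lemma adjacent_intro P x y : vertex P x -> vertex P y -> x <> y ->
  (forall z, (forall c, c \in P -> tight c x -> tight c y -> dot c.1 z = 0) ->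
     exists a : R, z = a *: (y - x)) ->
  adjacent P x y.
Proof.
move=> vx vy ne h; split=> //.
have Px := vertex_feasible vx; have Py := vertex_feasible vy.
pose L := [seq c <- P | tight c x && tight c y].
have LP : {subset L <= P} by apply: mem_subseq (filter_subseq _ _).
have Lx c : c \in L -> tight c x by rewrite mem_filter => /andP[/andP[]].
have Ly c : c \in L -> tight c y by rewrite mem_filter => /andP[/andP[]].
exists (\sum_(c <- L) c.1) => z; split=> [[Pz hz]|sz].
  have tz : forall c, c \in L -> tight c z.
    apply: sum_tight Lx (hz _ Px).
    by move=> c /LP; apply/feasibleP.
  have [a za] : exists a : R, z - x = a *: (y - x).
    apply: h => c cP tx ty; have /tz tcz : c \in L by rewrite mem_filter tx ty.
    by rewrite dotBr (eqP tcz) (eqP tx) subrr.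
  have zE : z = x + a *: (y - x) by rewrite -za addrC subrK.
  exists a; split; last by rewrite zE; apply/rowP => i; rewrite !mxE; ring.
  rewrite (vertex_not_between vx Py) //= -?zE //.
  have : 0 <= 1 - a; last by lra.
  apply: (@vertex_not_between P y x _ vy Px); first by move/esym.
  by rewrite (_ : _ + _ = z) // zE; apply/rowP => i; rewrite !mxE; ring.
split; first exact: feasible_segment sz.
have [s [_ ->]] := sz.
move=> p Pp; have exy : dot (\sum_(c <- L) c.1) x = dot (\sum_(c <- L) c.1) y.
  by apply: le_anti; rewrite (tight_sum_max LP Lx Py) (tight_sum_max LP Ly Px).
by rewrite !dotE exy -mulrDl subrK mul1r; apply: tight_sum_max LP Ly _ Pp.
Qed.

End Geometry.

(** * Simple polytopes *)

Section SimplePolytopes.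
Variables (R : realType) (d : nat).
Implicit Types (P L : hdesc R d) (c t : ineq R d) (x y z w p : 'rV[R]_d).

(* The edge of P leaving x along which c stops being tight ends at y. *)
Definition drops P x c y :=
  [/\ c \in P, tight c x, ~~ tight c y &
      forall c', c' \in P -> tight c' x -> c' != c -> tight c' y].

Lemma simple_uniq P x : simple P -> vertex P x -> uniq (tight_ineqs P x).
Proof. by move=> sP vx; apply: spans_uniq; [have /vertexP[] := vx|apply: sP]. Qed.

Lemma parallel_of_drop P x c z p : vertex P x -> c \in P -> tight c x ->
  (forall c', c' \in P -> tight c' x -> c' != c -> dot c'.1 p = 0) ->
  dot c.1 p != 0 ->
  (forall c', c' \in P -> tight c' x -> c' != c -> dot c'.1 z = 0) ->
  z = (dot c.1 z / dot c.1 p) *: p.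
Proof.
move=> /vertexP[_ sx] cP tc hp cp hz; apply/eqP; rewrite -subr_eq0.
apply/eqP/sx => c'; rewrite mem_tight => /andP[tc' c'P]; rewrite !dotE.
have [->|nc] := eqVneq c' c; first by rewrite divfK // subrr.
by rewrite (hz c') // (hp c') // mulr0 subrr.
Qed.

Lemma drops_dot P x c y : drops P x c y ->
  forall c', c' \in P -> tight c' x -> c' != c -> dot c'.1 (y - x) = 0.
Proof.
move=> [_ _ _ h] c' c'P tc' nc; rewrite dotBr (eqP tc') (eqP (h _ c'P tc' nc)).
exact: subrr.
Qed.

Lemma drops_dot_lt0 P x c y : feasible P y -> drops P x c y ->
  dot c.1 (y - x) < 0.
Proof.
move=> /feasibleP Py [cP tx ty _]; rewrite dotBr (eqP tx) subr_lt0 lt_neqAle.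
by rewrite Py // andbT.
Qed.

Lemma drops_neq P x c y : drops P x c y -> x <> y.
Proof. by move=> [_ tx ty _] exy; rewrite exy in tx; rewrite tx in ty. Qed.

(** If two tight inequalities were lost, at most $d-2$ would stay tight on the edge. Some [z] is
    then orthogonal to these and to [y - x]; moving the midpoint along [z] stays in the exposed
    face, so [z] is also parallel to [y - x]. *)
Lemma adjacent_drops P x y : simple P -> adjacent P x y ->
  exists c, drops P x c y.
Proof.
move=> sP [vx vy ne [g hg]].
have Px := vertex_feasible vx; have Py := vertex_feasible vy.
have [c cP /andP[tx ty]] : exists2 c, c \in P & tight c x && ~~ tight c y.
  apply/hasP; apply: contra_notT ne => /hasPn h; apply/esym/(vertex_determined vx).
  by move=> c cP tx; have := h c cP; rewrite tx negbK.
exists c; split=> // c' c'P tx' nc; apply/negPn/negP => ty'.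
pose L := [seq c <- tight_ineqs P x | tight c y].
(* The vector [y - x] is added as the normal of an artificial inequality, whose right-hand side is
   irrelevant. *)
have ltL : (size ((y - x, 0)%R :: L) < d)%N.
  have : (size [:: c, c' & L] <= size (tight_ineqs P x))%N.
    apply: uniq_leq_size => [|a].
      rewrite /= !inE eq_sym (negPf nc) !mem_filter (negPf ty) (negPf ty') /=.
      exact: filter_uniq (simple_uniq sP vx).
    rewrite !inE => /or3P[/eqP ->|/eqP ->|].
    - by rewrite mem_tight tx.
    - by rewrite mem_tight tx'.
    - by rewrite mem_filter => /andP[].
  by rewrite (sP _ vx).
have [z zn0 hz] := exists_orthogonal ltL.
have zyx : dot (y - x) z = 0 by apply: (hz (y - x, 0)); rewrite mem_head.
pose m := 2^-1 *: (x + y).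
have mE : m = (1 - 2^-1) *: x + 2^-1 *: y.
  by apply/rowP => i; rewrite !mxE; field.
have half : (0 < 2^-1 :> R) && (2^-1 < 1 :> R) by lra.
have sm : on_segment x y m by exists 2^-1; split=> //; lra.
have [Pm mm] : max_face P g m by apply/hg.
have zt e : e = 1 \/ e = -1 -> forall a, a \in P -> tight a m -> dot a.1 (e *: z) <= 0.
  move=> _ a aP; rewrite mE (tight_between Px Py half aP) => /andP[ax ay].
  by rewrite dotZr (hz a) ?mulr0 // inE mem_filter ay mem_tight ax aP orbT.
have [e e0 he] := feasible_perturb Pm (zt 1 (or_introl erefl)).
have [f f0 hf] := feasible_perturb Pm (zt (-1) (or_intror erefl)).
have Pe : feasible P (m + e *: (1 *: z)) by apply: he; lra.
have Pf : feasible P (m + f *: (-1 *: z)) by apply: hf; lra.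
have gz : dot g z = 0.
  have := mm _ Pe; have := mm _ Pf; rewrite !dotE; nra.
have : max_face P g (m + e *: (1 *: z)).
  by split=> // p /mm; rewrite !dotE gz !mulr0 addr0.
move/hg => [s [_ ezE]].
have ez : z = ((s - 2^-1) / e) *: (y - x).
  apply/rowP => i; move/rowP/(_ i): ezE; rewrite mE !mxE mul1r => h.
  by rewrite mulrAC; apply: (canRL (mulfK (lt0r_neq0 e0))); lra.
move/eqP: zn0; apply; apply: dot_self_eq0.
by rewrite {1}ez dotC dotZr dotC zyx mulr0.
Qed.

Lemma drops_adjacent P x c y :
  vertex P x -> vertex P y -> drops P x c y -> adjacent P x y.
Proof.
move=> vx vy dr; apply: adjacent_intro => //; first exact: drops_neq dr.
have lt0 := drops_dot_lt0 (vertex_feasible vy) dr.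
move=> z hz; exists (dot c.1 z / dot c.1 (y - x)).
have [cP tx ty h] := dr.
apply: (parallel_of_drop vx cP tx); [exact: drops_dot dr|by rewrite lt_eqF|].
by move=> c' c'P tx' nc; apply: hz => //; apply: h.
Qed.

(** A simplex pivot: the ray given by the dual vector of [c] keeps the rest of the basis tight, and
    the inequality met at its exit point completes a new basis. *)
Lemma neighbor_exists P x c : bounded_desc P -> simple P -> vertex P x ->
  c \in P -> tight c x -> exists2 y, vertex P y & drops P x c y.
Proof.
move=> bP sP vx cP tx; have [Px sx] := iffLR (vertexP P x) vx.
have [||z cz hz] := @dual_vector _ _ _ c sx; first exact: sP.
  by rewrite mem_tight tx.
have hz' c' : c' \in P -> tight c' x -> c' != c -> dot c'.1 z = 0.
  by move=> c'P tx' nc; apply: hz; apply: rem_mem; rewrite // mem_tight tx'.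
have zn0 : z != 0.
  by apply/eqP => z0; move: cz; rewrite z0 dot0r; lra.
have [|s [s0 Py [a [aP ta az]]]] := exit_point bP Px zn0.
  by move=> c' c'P tx'; have [->|nc] := eqVneq c' c; [rewrite cz; lra|rewrite hz'].
exists (x + s *: z).
  apply/vertexP; split=> // p hp.
  have ty c' : c' \in P -> tight c' x -> c' != c -> tight c' (x + s *: z).
    by move=> c'P tx' nc; rewrite /tight !dotE hz' // mulr0 addr0.
  have pE : p = (dot c.1 p / dot c.1 z) *: z.
    apply: (parallel_of_drop vx cP tx hz'); first by rewrite cz; lra.
    by move=> c' c'P tx' nc; apply: hp; rewrite mem_tight ty.
  have : dot a.1 p = 0 by apply: hp; rewrite mem_tight ta.
  rewrite pE dotZr => /eqP; rewrite mulf_eq0 (gt_eqF az) orbF => /eqP ->.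
  by rewrite scale0r.
split=> //; first by rewrite /tight !dotE cz (eqP tx); apply/eqP; lra.
by move=> c' c'P tx' nc; rewrite /tight !dotE hz' // mulr0 addr0.
Qed.

(** At a simple vertex the edge directions are dual to the tight normals up to negative factors, so
    each coefficient is a quotient of two products with the same normal, the upper one nonpositive
    and the lower one negative. *)
Lemma cone_decomposition P x (y : ineq R d -> 'rV[R]_d) p :
  simple P -> vertex P x -> feasible P p ->
  (forall c, c \in P -> tight c x -> feasible P (y c) /\ drops P x c (y c)) ->
  exists2 l : ineq R d -> R, (forall c, c \in tight_ineqs P x -> 0 <= l c) &
    p - x = \sum_(c <- tight_ineqs P x) l c *: (y c - x).
Proof.
move=> sP vx /feasibleP Pp hy; have [Px sx] := iffLR (vertexP P x) vx.
have lt0 c : c \in tight_ineqs P x -> dot c.1 (y c - x) < 0.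
  rewrite mem_tight => /andP[tx cP]; have [Py dr] := hy c cP tx.
  exact: drops_dot_lt0 Py dr.
exists (fun c => dot c.1 (p - x) / dot c.1 (y c - x)).
  move=> c cT; have := lt0 c cT; move: cT; rewrite mem_tight => /andP[tx cP] lt.
  rewrite -[leRHS]mulrNN mulr_ge0 // ?oppr_ge0; last by rewrite invr_le0 ltW.
  by rewrite dotBr (eqP tx) subr_le0 Pp.
apply/eqP; rewrite -subr_eq0; apply/eqP/sx => c cT.
rewrite dotBr dot_sumr (bigD1_seq c) //= ?simple_uniq //.
rewrite dotZr divfK ?lt_eqF ?lt0 // big_seq_cond big1 ?addr0 ?subrr //.
move=> c' /andP[c'T nc]; rewrite dotZr; move: c'T; rewrite mem_tight => /andP[tx' c'P].
have [_ dr] := hy c' c'P tx'; move: cT; rewrite mem_tight => /andP[tx cP].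
by rewrite (drops_dot dr cP tx) ?mulr0 // eq_sym.
Qed.

Lemma neighbor_fun P x : bounded_desc P -> simple P -> vertex P x ->
  exists y : ineq R d -> 'rV[R]_d, forall c, c \in P -> tight c x ->
    vertex P (y c) /\ drops P x c (y c).
Proof.
move=> bP sP vx.
suff /choice[f hf] : forall c, exists y, c \in P -> tight c x ->
    vertex P y /\ drops P x c y by exists f.
move=> c.
have [/andP[cP tx]|h] := boolP ((c \in P) && tight c x).
  by have [y vy dr] := neighbor_exists bP sP vx cP tx; exists y.
by exists 0 => cP tx; rewrite cP tx in h.
Qed.

(** If no edge at [x] increased [g], no nonnegative combination of edge directions would, and
    [p - x] is such a combination. *)
Lemma improving_neighbor P x g p : bounded_desc P -> simple P -> vertex P x ->
  feasible P p -> dot g x < dot g p ->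
  exists2 y, adjacent P x y & dot g x < dot g y.
Proof.
move=> bP sP vx Pp lt; have [y hy] := neighbor_fun bP sP vx.
have [|l l0 pE] := cone_decomposition sP vx Pp (y := y).
  by move=> c cP tx; have [/vertex_feasible] := hy c cP tx.
have [/hasP[c]|/hasPn h] :=
    boolP (has (fun c => dot g x < dot g (y c)) (tight_ineqs P x)).
  rewrite mem_tight => /andP[tx cP] gc; exists (y c) => //.
  by have [vy dr] := hy c cP tx; apply: drops_adjacent dr.
suff : dot g (p - x) <= 0 by rewrite dotBr; lra.
rewrite pE dot_sumr big_seq sumr_le0 // => c cT; rewrite dotZr mulr_ge0_le0 ?l0 //.
by rewrite dotBr subr_le0 leNgt h.
Qed.

(** * Walks, distances and the diameter *)

Lemma walk_cat P m n x y z : walk P m x y -> walk P n y z -> walk P (m + n) x z.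
Proof.
elim: m x => [|m IH] x /=; first by move=> ->.
by move=> [p [xp wp]] wz; exists p; split=> //; apply: IH.
Qed.

Lemma walk1 P x y : adjacent P x y -> walk P 1 x y.
Proof. by move=> h; exists y. Qed.

Lemma walk_sym P n x y : walk P n x y -> walk P n y x.
Proof.
elim: n x => [|n IH] x /=; first by move=> ->.
move=> [z [xz /IH wz]]; have := walk_cat wz (walk1 (adjacent_sym xz)).
by rewrite addn1.
Qed.

(** Encodes vertices in a finite type, so that the vertices still ahead of a walk can be counted. *)
Definition tight_mask P x : (size P).-tuple bool :=
  map_tuple (fun c => tight c x) (in_tuple P).

Lemma tight_mask_inj P x y : vertex P x -> tight_mask P x = tight_mask P y -> y = x.
Proof.
move=> vx /(congr1 (@tval _ _)) /= /eq_in_map h.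
by apply: vertex_determined vx _ => c cP; rewrite h.
Qed.

(* The simplex method: increasing the functional g that exposes y, one reaches
   y from any vertex, and no tight set is met twice. *)
Lemma connected P x y : bounded_desc P -> simple P -> vertex P x -> vertex P y ->
  exists2 n, (n <= 2 ^ size P)%N & walk P n x y.
Proof.
move=> bP sP vx vy; have [g hg] := vy; have [Py my] := iffRL (hg y) erefl.
(* The tight sets of the vertices strictly higher than [x]; this set shrinks strictly with each
   improving step, which bounds the length of the walk. *)
pose ups x : {set (size P).-tuple bool} := [set m | `[<exists p,
  [/\ vertex P p, tight_mask P p = m & dot g x < dot g p]>]].
suff [n le wn] : exists2 n, (n <= #|ups x|)%N & walk P n x y.
  exists n => //; rewrite (leq_trans le) // (leq_trans (max_card _)) //.
  by rewrite card_tuple card_bool.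
have [N] := ubnP #|ups x|; elim: N x vx => // N IH x vx ltN.
have [->|ne] := pselect (x = y); first by exists 0%N.
have lt : dot g x < dot g y.
  rewrite ltNge; apply/negP => le; apply: ne; apply/hg.
  by split=> [|p /my /le_trans]; [exact: vertex_feasible|exact].
have [x' xx' lt'] := improving_neighbor bP sP vx Py lt.
have [_ vx' _ _] := xx'.
have prop : ups x' \proper ups x.
  apply/properP; split.
    apply/fintype.subsetP => m; rewrite !inE => -[p [vp pm ltp]]; exists p.
    by split=> //; apply: lt_trans ltp.
  exists (tight_mask P x'); first by rewrite inE; apply/asboolP; exists x'.
  rewrite inE; apply/negP => /asboolP[p [vp /(tight_mask_inj vp) <-]].
  by rewrite ltxx.
have ltc := proper_card prop.
have [|n le wn] := IH x' vx'; first exact: leq_trans ltc _.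
by exists n.+1; [apply: leq_ltn_trans le ltc|exists x'].
Qed.

Lemma connected_dist P x y : bounded_desc P -> simple P -> vertex P x ->
  vertex P y -> exists2 n, (n <= 2 ^ size P)%N & is_dist P x y n.
Proof.
move=> bP sP vx vy; have [n le wn] := connected bP sP vx vy.
have ex : exists n, `[<walk P n x y>] by exists n; apply/asboolP.
case: (ex_minnP ex) => m /asboolP wm hm.
have hm' k : walk P k x y -> (m <= k)%N by move=> wk; apply/hm/asboolP.
by exists m => //; apply: leq_trans le; apply: hm'.
Qed.

Lemma is_dist_uniq P x y m n : is_dist P x y m -> is_dist P x y n -> m = n.
Proof.
by move=> [wm hm] [wn hn]; apply/eqP; rewrite eqn_leq hm // hn.
Qed.

Lemma distP P x y : bounded_desc P -> simple P -> vertex P x -> vertex P y ->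
  is_dist P x y (dist P x y).
Proof.
move=> bP sP vx vy; have [n _ hn] := connected_dist bP sP vx vy.
exact: xgetPex (ex_intro _ n hn).
Qed.

Lemma is_diam_uniq P m n : is_diam P m -> is_diam P n -> m = n.
Proof.
suff h a b : is_diam P a -> is_diam P b -> (a <= b)%N.
  by move=> hm hn; apply/eqP; rewrite eqn_leq !h.
move=> [_ [x [y [vx vy hxy]]]] [h _]; have [k [hk le]] := h x y vx vy.
by rewrite (is_dist_uniq hxy hk).
Qed.

Lemma diamE P n : is_diam P n -> diam P = n.
Proof. by move=> hn; apply: is_diam_uniq (xgetPex _ (ex_intro _ n hn)) hn. Qed.

(** As [diam] is defined by choice, a diameter must first be shown to exist: it is the largest
    distance realized, and distances are bounded by $2^{|P|}$. *)
Lemma dist_le_diam P x y : bounded_desc P -> simple P -> vertex P x ->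
  vertex P y -> (dist P x y <= diam P)%N.
Proof.
move=> bP sP vx vy.
pose D n := `[<exists x y, [/\ vertex P x, vertex P y & is_dist P x y n]>].
have exD : exists n, D n.
  have [n _ hn] := connected_dist bP sP vx vy.
  by exists n; apply/asboolP; exists x, y.
have bD n : D n -> (n <= 2 ^ size P)%N.
  move=> /asboolP[a [b [va vb hn]]]; have [m le hm] := connected_dist bP sP va vb.
  by rewrite (is_dist_uniq hn hm).
case: (ex_maxnP exD bD) => N /asboolP hN maxN.
have isN : is_diam P N.
  split=> // a b va vb; have [m _ hm] := connected_dist bP sP va vb.
  by exists m; split=> //; apply/maxN/asboolP; exists a, b.
rewrite (diamE isN); apply/maxN/asboolP; exists x, y; split=> //.
exact: distP.
Qed.

End SimplePolytopes.

(** * Truncation *)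

Section Truncation.
Variables (R : realType) (d : nat) (P : hdesc R d) (w : 'rV[R]_d) (t : ineq R d).
Hypotheses (bP : bounded_desc P) (sP : simple P) (trP : truncating P w t).

Let mid x : 'rV[R]_d := 2^-1 *: (w + x).

Let vw : vertex P w. Proof. by case: trP. Qed.

Let t_w : t.2 < dot t.1 w.
Proof. by case: trP => _ _; rewrite /sat -ltNge. Qed.

Let t_neighbor x : adjacent P w x -> dot t.1 x - t.2 = t.2 - dot t.1 w.
Proof.
case: trP => _ h _ /h; rewrite /tight !dotE => /eqP <-.
by field.
Qed.

(** Write [x - w] as a combination of edge directions with coefficient sum [s]. All neighbors have
    the same value under [t], so [t] at [x] depends on [s] alone, and $s\ge 1$ suffices. If $s<1$,
    every inequality tight at [x] is tight at [w], whence [x = w]. *)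
Lemma truncating_lt x : vertex P x -> x <> w -> dot t.1 x < t.2.
Proof.
move=> vx ne; have [y hy] := neighbor_fun bP sP vw.
have Px := vertex_feasible vx; have /feasibleP Pw := vertex_feasible vw.
have [|l l0 xE] := cone_decomposition sP vw Px (y := y).
  by move=> c cP tx; have [/vertex_feasible] := hy c cP tx.
pose s := \sum_(c <- tight_ineqs P w) l c.
have txE : dot t.1 x = dot t.1 w + s * (2 * (t.2 - dot t.1 w)).
  rewrite -[x in LHS](subrK w) dotDr xE addrC dot_sumr mulr_suml; congr (_ + _).
  rewrite big_seq [RHS]big_seq; apply: eq_bigr => c; rewrite mem_tight => /andP[tc cP].
  have [vy dr] := hy c cP tc; rewrite !dotE; congr (_ * _).
  have := t_neighbor (drops_adjacent vw vy dr); lra.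
have [s1|s1] := ltP s 1; last by move: t_w; rewrite txE; nra.
case: ne; apply/esym/(vertex_determined vx) => c cP tc.
suff : (1 - s) * (c.2 - dot c.1 w) <= 0.
  have := Pw c cP; rewrite le_eqVlt => /predU1P[/eqP //|lt].
  by rewrite pmulr_rle0 ?subr_gt0 // subr_le0 leNgt lt.
have : dot c.1 x - dot c.1 w <= s * (c.2 - dot c.1 w).
  rewrite -dotBr xE dot_sumr mulr_suml big_seq [leRHS]big_seq; apply: ler_sum => a aT.
  rewrite dotZr ler_wpM2l ?l0 // dotBr lerD2r.
  move: aT; rewrite mem_tight => /andP[ta aP].
  by have [/vertex_feasible/feasibleP Py _] := hy a aP ta; apply: Py.
by rewrite (eqP tc); lra.
Qed.

Lemma truncating_notin : t \notin P.
Proof.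
apply/negP => tP; have /feasibleP/(_ t tP) := vertex_feasible vw.
by move: t_w; lra.
Qed.

Lemma truncation_bounded : bounded_desc (P ++ [:: t]).
Proof.
have [M hM] := bP; exists M => x; rewrite /feasible all_cat => /andP[Px _].
exact: hM.
Qed.

Lemma old_vertex_truncation x : vertex P x -> x <> w ->
  vertex (P ++ [:: t]) x /\ ~~ tight t x.
Proof.
move=> vx ne; have lt := truncating_lt vx ne.
have ntx : ~~ tight t x by rewrite /tight lt_eqF.
split=> //; have [Px sx] := iffLR (vertexP P x) vx.
apply/vertexP; split; first by rewrite /feasible all_cat -/(feasible P x) Px /= /sat ltW.
by rewrite /tight_ineqs filter_cat /= (negPf ntx) cats0.
Qed.

Lemma midE x : mid x = (1 - 2^-1) *: w + 2^-1 *: x.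
Proof. by apply/rowP => i; rewrite !mxE; field. Qed.

Lemma tight_mid x c : vertex P x -> c \in P -> tight c (mid x) = tight c w && tight c x.
Proof.
move=> vx cP; rewrite midE (tight_between (vertex_feasible vw) (vertex_feasible vx)) //.
by lra.
Qed.

Lemma tight_mid_new x : adjacent P w x -> tight t (mid x).
Proof. by case: trP => _ h _ /h. Qed.

(** The old inequalities tight at the midpoint are those of the edge and leave only its direction
    free; [t] is not constant along it. *)
Lemma mid_vertex_truncation x : adjacent P w x -> vertex (P ++ [:: t]) (mid x).
Proof.
move=> wx; have tmx := tight_mid_new wx; have [_ vx ne _] := wx.
have Px := vertex_feasible vx; have Pw := vertex_feasible vw.
apply/vertexP; split.
  rewrite /feasible all_cat; apply/andP; split; last first.
    by rewrite /= /sat (eqP tmx) lexx.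
  by apply: (feasible_segment Pw Px); exists 2^-1; rewrite midE; split=> //; lra.
have [c dr] := adjacent_drops sP wx; have lt0 := drops_dot_lt0 Px dr.
have [cP tw ntx h] := dr.
move=> z hz; have zE : z = (dot c.1 z / dot c.1 (x - w)) *: (x - w).
  apply: (parallel_of_drop vw cP tw (drops_dot dr)); first by rewrite lt_eqF.
  move=> c' c'P tc' nc; apply: hz.
  by rewrite mem_tight mem_cat c'P tight_mid // tc' h.
have : dot t.1 z = 0 by apply: hz; rewrite mem_tight tmx mem_cat mem_head orbT.
rewrite zE dotZr => /eqP; rewrite mulf_eq0 => /orP[/eqP->|]; first by rewrite scale0r.
by have := t_neighbor wx; rewrite dotBr => e1 /eqP e2; exfalso; move: t_w; lra.
Qed.

(** All inequalities of [P] tight at [x] stay tight along [z]. The one met at the exit point removes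
    the last degree of freedom, so that point is a vertex of [P]. *)
Let exit_vertex x z : feasible P x -> tight t x ->
  spans (tight_ineqs (P ++ [:: t]) x) -> dot t.1 z != 0 ->
  (forall c, c \in P -> tight c x -> dot c.1 z = 0) ->
  exists s : R, [/\ 0 < s, vertex P (x + s *: z) &
    forall c, c \in P -> tight c x -> tight c (x + s *: z)].
Proof.
move=> Px tx sx tz hz.
have zn0 : z != 0 by apply: contraNneq tz => ->; rewrite dot0r.
have [|s [s0 Ps [a [aP ta az]]]] := exit_point bP Px zn0.
  by move=> c cP tc; rewrite hz.
have ts c : c \in P -> tight c x -> tight c (x + s *: z).
  by move=> cP tc; rewrite /tight !dotE hz // mulr0 addr0.
exists s; split=> //; apply/vertexP; split=> // p hp.
have pE : p = (dot t.1 p / dot t.1 z) *: z.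
  apply/eqP; rewrite -subr_eq0; apply/eqP/sx => c.
  rewrite mem_tight mem_cat inE => /andP[tc /orP[cP|/eqP ->]].
    by rewrite !dotE (hz c) // hp ?mulr0 ?subrr // mem_tight ts.
  by rewrite !dotE divfK // subrr.
have : dot a.1 p = 0 by apply: hp; rewrite mem_tight ta.
rewrite pE dotZr => /eqP; rewrite mulf_eq0 (gt_eqF az) orbF => /eqP ->.
by rewrite scale0r.
Qed.

(** A vertex on the new hyperplane is not a vertex of [P], so it lies inside a segment of [P] on
    which its old tight inequalities stay tight. The end of larger [t]-value violates [t] and must
    be [w]; the other is a neighbor [y] of [w], and the hyperplane meets this edge only in its
    midpoint. *)
Lemma truncation_vertex x : vertex (P ++ [:: t]) x ->
  (vertex P x /\ x <> w) \/ (exists2 y, adjacent P w y & x = mid y).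
Proof.
move=> /vertexP[]; rewrite {1}/feasible all_cat /= => /andP[Px /andP[stx _]] sx.
have xw : x <> w by move=> xw; move: t_w stx; rewrite xw /sat; lra.
have [tx|ntx] := boolP (tight t x); last first.
  left; split=> //; apply/vertexP; split=> //.
  by move: sx; rewrite /tight_ineqs filter_cat /= (negPf ntx) cats0.
right.
have [z [zn0 hz]] : exists z, z <> 0 /\ forall c, c \in P -> tight c x -> dot c.1 z = 0.
  apply: contrapT => /forallNP h.
  have : vertex P x.
    apply/vertexP; split=> // z hz; apply: contrapT => zn0.
    by apply: (h z); split=> // c cP tc; apply: hz; rewrite mem_tight tc.
  by move=> vx; have := truncating_lt vx xw; rewrite (eqP tx) ltxx.
(* Replacing [z] by its negative fixes the sign; the value zero would make [z] orthogonal to the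
   whole spanning tight set of [x]. *)
wlog tz : z zn0 hz / 0 < dot t.1 z.
  move=> W; have [|le|e] := ltgtP (dot t.1 z) 0.
  - move=> lt; apply: (W (- z)); last by rewrite dotNr oppr_gt0.
      by move/eqP; rewrite oppr_eq0 => /eqP.
    by move=> c cP tc; rewrite dotNr hz // oppr0.
  - exact: (W z).
  - case: zn0; apply: sx => c; rewrite mem_tight mem_cat inE.
    by move=> /andP[tc /orP[cP|/eqP -> //]]; apply: hz.
have [s [s0 v1 h1]] := exit_vertex Px tx sx (lt0r_neq0 tz) hz.
have [||s' [s'0 v2 h2]] := exit_vertex (z := - z) Px tx sx.
- by rewrite dotNr oppr_eq0 lt0r_neq0.
- by move=> c cP tc; rewrite dotNr hz // oppr0.
have wE : x + s *: z = w.
  apply: contrapT => ne; have := truncating_lt v1 ne.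
  by rewrite !dotE (eqP tx); nra.
pose y := x + s' *: - z; rewrite -/y in v2 h2.
have yw : y <> w.
  by move=> yw; move: t_w; rewrite -yw !dotE (eqP tx); nra.
have ywE : y - w = - (s + s') *: z.
  by rewrite -wE; apply/rowP => i; rewrite !mxE; ring.
have xE : x = w + - s *: z by rewrite -wE; apply/rowP => i; rewrite !mxE; ring.
have wy : adjacent P w y.
  apply: adjacent_intro => //; first by move/esym.
  move=> p hp; exists (dot t.1 p / dot t.1 (y - w)).
  have tyw : dot t.1 (y - w) != 0 
    by rewrite ywE dotZr mulf_neq0 ?(lt0r_neq0 tz) // lt_eqF //; lra.
  apply/eqP; rewrite -subr_eq0; apply/eqP/sx => c.
  rewrite mem_tight mem_cat inE => /andP[tc /orP[cP|/eqP ->]].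
    rewrite ywE !dotE (hz c) // hp ?mulr0 ?subrr //; last exact: h2.
    by rewrite -wE h1.
  by rewrite [LHS]dotBr dotZr divfK // subrr.
exists y => //.
have := t_neighbor wy; have yE : y = w + - (s + s') *: z by rewrite -ywE addrC subrK.
rewrite yE !dotE; move/eqP: tx; rewrite {1}xE !dotE => e1 e2.
have es : (s' - s) * dot t.1 z = 0 by lra.
have -> : s' = s.
  by apply/eqP; rewrite -subr_eq0; move/eqP: es; rewrite mulf_eq0 (gt_eqF tz) orbF.
by rewrite xE; apply/rowP => i; rewrite !mxE; field.
Qed.

(** A new vertex has lost exactly one inequality of the basis of [w] and has gained [t]. *)
Lemma truncation_simple : simple (P ++ [:: t]).
Proof.
move=> x /truncation_vertex[[vx ne]|[y wy ->]].
  have [_ ntx] := old_vertex_truncation vx ne.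
  by rewrite /tight_ineqs filter_cat /= (negPf ntx) cats0 -/(tight_ineqs P x) sP.
have [_ vy _ _] := wy; have [c [cP tw nty h]] := adjacent_drops sP wy.
rewrite /tight_ineqs filter_cat /= tight_mid_new // size_cat /= addn1.
rewrite (@eq_in_filter _ _ (fun c => tight c y && tight c w)); last first.
  by move=> c' c'P; rewrite tight_mid // andbC.
rewrite filter_predI -/(tight_ineqs P w) size_filter.
rewrite -[RHS](sP vw) -(count_predC (fun c => tight c y) (tight_ineqs P w)) -addn1.
congr (_ + _)%N; transitivity (count_mem c (tight_ineqs P w)).
  by rewrite count_uniq_mem ?simple_uniq // mem_tight tw cP.
apply/eq_in_count => c'; rewrite mem_tight /= => /andP[tw' c'P].
by have [->//|nc] := eqVneq c' c; rewrite ?h // (negPf nty).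
Qed.

End Truncation.

(** * Feasible bases in a silo *)

Section Silo.
Variables (R : realType) (d : nat) (P : hdesc R d) (w : 'rV[R]_d).
Variables (b t : nat -> ineq R d).
Hypotheses (bP : bounded_desc P) (sP : simple P) (silo : siloing P w b t).
Implicit Types (x y z : 'rV[R]_d) (c : ineq R d) (B T : pred nat).

Local Notation TT := (add_ineqs P t).
Local Notation S := (add_ineqs P t d).

Lemma mem_add_ineqs k c :
  c \in TT k <-> c \in P \/ exists2 i, (1 <= i <= k)%N & c = t i.
Proof.
rewrite mem_cat; split=> [/orP[->|/mapP[i]]|[->//|[i hi ->]]]; first by left.
  by rewrite mem_iota => hi ->; right; exists i => //; lia.
by apply/orP; right; apply/mapP; exists i; rewrite // mem_iota; lia.
Qed.

Lemma add_ineqsS k : TT k.+1 = TT k ++ [:: t k.+1].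
Proof. by rewrite /add_ineqs -[k.+1]addn1 iotaD map_cat /= catA add1n addn1. Qed.

Lemma silo_b_inj i j : (1 <= i <= d)%N -> (1 <= j <= d)%N -> b i = b j -> i = j.
Proof.
move=> hi hj e; have [ub _ _] := silo.
have := @nth_uniq _ (b 0%N) [seq b i | i <- iota 1 d] i.-1 j.-1.
rewrite size_map size_iota !(nth_map 0%N) ?size_iota; [|lia..].
rewrite !nth_iota; [|lia..]; rewrite !add1n !prednK; [|lia..].
rewrite e eqxx => h; have /esym/eqP := h ltac:(lia) ltac:(lia) ub; lia.
Qed.

Let tight_w c : tight c w && (c \in P) = (c \in [seq b i | i <- iota 1 d]).
Proof. by have [_ [_ h] _] := silo; rewrite -h mem_tight. Qed.

Lemma silo_b i : (1 <= i <= d)%N -> b i \in P /\ tight (b i) w.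
Proof.
move=> hi; have /andP[] : tight (b i) w && (b i \in P); last by [].
by rewrite tight_w; apply: map_f; rewrite mem_iota; lia.
Qed.

Lemma silo_tight_w c : c \in P -> tight c w -> exists2 i, (1 <= i <= d)%N & c = b i.
Proof.
move=> cP tw; have := tight_w c; rewrite tw cP => /esym /mapP[i].
by rewrite mem_iota => hi ->; exists i => //; lia.
Qed.

Lemma silo_vertex_w : vertex P w.
Proof. by have [_ [h _] _] := silo. Qed.

Lemma silo_t_fresh k : (k < d)%N -> t k.+1 \notin TT k.
Proof.
move=> kd; have [_ _ h] := silo; have [wk [_ tr]] := h k kd.
exact: truncating_notin tr.
Qed.

Lemma silo_t_notin i : (1 <= i <= d)%N -> t i \notin P.
Proof.
case: i => // i hi; apply: contra (silo_t_fresh (k := i) ltac:(lia)) => tP.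
by apply/mem_add_ineqs; left.
Qed.

Lemma silo_t_inj i j : (1 <= i <= d)%N -> (1 <= j <= d)%N -> t i = t j -> i = j.
Proof.
wlog le : i j / (i < j)%N.
  move=> W hi hj e; case: (ltngtP i j) => // lt; first exact: W.
  exact/esym/W.
case: j le => // j le hi hj e; have /negP[] := silo_t_fresh (k := j) ltac:(lia).
by apply/mem_add_ineqs; right; exists i => //; lia.
Qed.

(* x is the vertex of T^k whose feasible basis is
   {b_i : B i} together with {t_i : T i}. *)
Definition sig k B T x :=
  [/\ vertex (TT k) x,
      forall c, c \in P -> tight c x -> exists2 i, (1 <= i <= d)%N & c = b i,
      forall i, (1 <= i <= d)%N -> tight (b i) x = B i &
      forall i, (1 <= i <= k)%N -> tight (t i) x = T i].

Lemma sig_ext k B T B' T' x :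
  (forall i, (1 <= i <= d)%N -> B i = B' i) ->
  (forall i, (1 <= i <= k)%N -> T i = T' i) -> sig k B T x -> sig k B' T' x.
Proof.
move=> hB hT [vx hP hb ht]; split=> // i hi; first by rewrite hb // hB.
by rewrite ht // hT.
Qed.

Lemma sig_tight k B T x c : sig k B T x -> c \in TT k -> tight c x ->
  (exists i, [/\ (1 <= i <= d)%N, B i & c = b i]) \/
  (exists i, [/\ (1 <= i <= k)%N, T i & c = t i]).
Proof.
move=> [vx hP hb ht] /mem_add_ineqs[cP tx|[i hi ->] tx]; last first.
  by right; exists i; rewrite -ht.
have [i hi ci] := hP c cP tx; left; exists i; split=> //.
by rewrite -hb // -ci.
Qed.

Lemma sig_basis k B T x L : sig k B T x ->
  (forall c, (c \in L) <->
    (exists i, [/\ (1 <= i <= d)%N, B i & c = b i]) \/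
    (exists i, [/\ (1 <= i <= k)%N, T i & c = t i])) ->
  vertex_with_basis (TT k) L x.
Proof.
move=> sx hL; have [vx hP hb ht] := sx; split=> // c; rewrite mem_tight.
apply/andP/idP => [[tx cT]|/hL]; first by apply/hL; apply: sig_tight sx cT tx.
move=> [[i [hi Bi ->]]|[i [hi Ti ->]]]; split; rewrite ?hb ?ht //.
- by apply/mem_add_ineqs; left; have [] := silo_b hi.
- by apply/mem_add_ineqs; right; exists i.
Qed.

Lemma vertex_with_basis_uniq k L x y :
  vertex_with_basis (TT k) L x -> vertex_with_basis (TT k) L y -> x = y.
Proof.
move=> [_ hx] [vy hy]; apply: (vertex_determined vy) => c cT ty.
have : c \in tight_ineqs (TT k) x by rewrite hx -hy mem_tight ty.
by rewrite mem_tight => /andP[].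
Qed.

Lemma sig_uniq k B T x y : sig k B T x -> sig k B T y -> x = y.
Proof.
move=> sx sy; have [vy _ _ _] := sy; have [_ _ hb ht] := sx.
apply: (vertex_determined vy) => c cT ty.
by case: (sig_tight sy cT ty) => -[i [hi h ->]]; rewrite ?hb ?ht.
Qed.

(** One formula serves both cases of [phi_basis]: [a] is removed from both index sets, but belongs
    to only one of them when $a\ne e$. *)
Definition phiB a e i := (e <= i)%N && (i != a).
Definition phiT a e i := (i <= e)%N && (i != a).
Definition wB k i := (k < i)%N.
Definition wT k i := (i <= k)%N.

Lemma sig_phi_basis a e x : (1 <= e <= d)%N -> a != e ->
  sig d (phiB a e) (phiT a e) x -> is_phi P b t a e x.
Proof.
move=> he ne sx; apply: (sig_basis sx) => c; rewrite /phi_basis.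
split.
  case: ltnP => ae; rewrite mem_cat => /orP[]/mapP[i];
    rewrite ?mem_filter mem_iota => hi ->; [left|right|left|right]; exists i;
    rewrite /phiB /phiT; split=> //; lia.
move=> [[i [hi hBi ->]]|[i [hi hTi ->]]]; case: ltnP => ae; rewrite mem_cat; apply/orP;
  move: hBi hTi || move: hBi || move: hTi; rewrite /phiB /phiT => h;
  [left|left|right|right]; apply: map_f; rewrite ?mem_filter mem_iota; lia.
Qed.

Lemma sig_w_basis k x : (k <= d)%N -> sig k (wB k) (wT k) x ->
  vertex_with_basis (TT k)
    ([seq b i | i <- iota 1 d & (k < i)%N] ++ [seq t i | i <- iota 1 k]) x.
Proof.
move=> kd sx; apply: (sig_basis sx) => c; split.
  rewrite mem_cat => /orP[]/mapP[i]; rewrite ?mem_filter mem_iota => hi ->;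
    [left|right]; exists i; rewrite /wB /wT; split=> //; lia.
rewrite /wB /wT mem_cat => -[[i [hi hBi ->]]|[i [hi hTi ->]]]; apply/orP; [left|right];
  apply: map_f; rewrite ?mem_filter mem_iota; lia.
Qed.

Lemma sig_peak x : sig d (wB d) (wT d) x -> is_peak P t x.
Proof.
move/(sig_w_basis (leqnn d)); rewrite (_ : [seq i <- iota 1 d | _] = [::]) //.
by apply/eqP; rewrite -(negbK (_ == _)) -has_filter -all_predC; apply/allP => i /=;
   rewrite mem_iota; lia.
Qed.

Lemma sig_w0 x : sig 0 (wB 0) (wT 0) x -> x = w.
Proof.
move=> [vx _ hb _]; apply: (vertex_determined silo_vertex_w) => c cP tw.
by have [i hi ->] := silo_tight_w cP tw; rewrite hb // /wB; case/andP: hi.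
Qed.

Section Step.
Variables (k : nat) (wk : 'rV[R]_d).
Hypotheses (kd : (k < d)%N) (bk : bounded_desc (TT k)) (sk : simple (TT k)).
Hypotheses (sigk : sig k (wB k) (wT k) wk) (trk : truncating (TT k) wk (t k.+1)).

(** The new vertex on the edge of [wk] that drops [c] exchanges [c] for $t_{k+1}$. The three lemmas
    that follow read off the result: dropping $b_{k+1}$ gives $w^{k+1}$, and dropping another $b_a$
    or a $t_a$ gives $\phi(a,k+1)$. *)
Lemma mid_sig y c : vertex (TT k) y -> drops (TT k) wk c y ->
  sig k.+1 (fun i => (k < i)%N && (b i != c))
      (fun i => (i == k.+1) || ((i <= k)%N && (t i != c))) (2^-1 *: (wk + y)).
Proof.
move=> vy dr; have [vw hP hb ht] := sigk.
have wy := drops_adjacent vw vy dr; have [cT tc ntc h] := dr.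
have tm c' : c' \in TT k -> tight c' (2^-1 *: (wk + y)) = tight c' wk && (c' != c).
  move=> c'T; rewrite (tight_mid trk) //; have [/= tw|//] := boolP (tight c' wk).
  by have [->|nc] := eqVneq c' c; [rewrite (negPf ntc)|rewrite h].
split.
- by rewrite add_ineqsS; apply: mid_vertex_truncation.
- move=> c' c'P; rewrite tm; first by move=> /andP[tw _]; apply: hP.
  by apply/mem_add_ineqs; left.
- move=> i hi; rewrite tm ?hb //; apply/mem_add_ineqs; left.
  by have [] := silo_b hi.
- move=> i hi; have [->|ne] := eqVneq i k.+1; first by rewrite (tight_mid_new trk).
  have hi' : (1 <= i <= k)%N by lia.
  by rewrite tm ?ht //; apply/mem_add_ineqs; right; exists i.
Qed.

Lemma mid_sig_b y a : vertex (TT k) y -> (k.+1 < a <= d)%N ->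
  drops (TT k) wk (b a) y ->
  sig k.+1 (phiB a k.+1) (phiT a k.+1) (2^-1 *: (wk + y)).
Proof.
move=> vy ha dr; apply: sig_ext (mid_sig vy dr) => i hi; rewrite /phiB /phiT.
  rewrite (_ : (b i == b a) = (i == a)) //.
  by apply/eqP/eqP => [/silo_b_inj|->] //; apply; lia.
have -> : t i != b a; last by lia.
have [aP _] := @silo_b a ltac:(lia).
by apply: contraNneq (silo_t_notin (i := i) ltac:(lia)) => ->.
Qed.

Lemma mid_sig_w y : vertex (TT k) y -> drops (TT k) wk (b k.+1) y ->
  sig k.+1 (wB k.+1) (wT k.+1) (2^-1 *: (wk + y)).
Proof.
move=> vy dr; apply: sig_ext (mid_sig vy dr) => i hi; rewrite /wB /wT.
  rewrite (_ : (b i == b k.+1) = (i == k.+1)); first by lia.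
  by apply/eqP/eqP => [/silo_b_inj|->] //; apply; lia.
have -> : t i != b k.+1; last by lia.
have [aP _] := @silo_b k.+1 ltac:(lia).
by apply: contraNneq (silo_t_notin (i := i) ltac:(lia)) => ->.
Qed.

Lemma mid_sig_t y a : vertex (TT k) y -> (1 <= a <= k)%N ->
  drops (TT k) wk (t a) y ->
  sig k.+1 (phiB a k.+1) (phiT a k.+1) (2^-1 *: (wk + y)).
Proof.
move=> vy ha dr; apply: sig_ext (mid_sig vy dr) => i hi; rewrite /phiB /phiT.
  have -> : b i != t a; last by lia.
  have [aP _] := @silo_b i ltac:(lia).
  by apply: contraNneq (silo_t_notin (i := a) ltac:(lia)) => <-.
rewrite (_ : (t i == t a) = (i == a)); first by lia.
by apply/eqP/eqP => [/silo_t_inj|->] //; apply; lia.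
Qed.

Lemma phi_sig_step a e x : (1 <= a <= d)%N -> (1 <= e <= k)%N -> a != e ->
  sig k (phiB a e) (phiT a e) x -> sig k.+1 (phiB a e) (phiT a e) x.
Proof.
move=> ha he ne [vx hP hb ht].
have nw : x <> wk.
  move=> xw; have [_ _ hb' ht'] := sigk; rewrite -xw in hb' ht'.
  (* The vertex differs from $w^k$ in $b_k$, tight only at $\phi(a,k)$, when $e=k$, and in $t_k$,
     tight only at $w^k$, when $e<k$. *)
  have [ek|ek] := eqVneq e k.
    have hk : (1 <= k <= d)%N by lia.
    by have := hb k hk; rewrite hb' // /wB /phiB; lia.
  have hk : (1 <= k <= k)%N by lia.
  by have := ht k hk; rewrite ht' // /wT /phiT; lia.
have [vx' nt] := old_vertex_truncation bk sk trk vx nw.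
split=> //; first by rewrite add_ineqsS.
move=> i hi; have [->|ni] := eqVneq i k.+1; last by rewrite ht //; lia.
by rewrite (negPf nt) /phiT; lia.
Qed.

End Step.

(** The induction carries the complete list of vertices of $T^k$ with their bases, since the next
    truncation is understood through the neighbors of $w^k$. *)
Lemma silo_invariant k : (k <= d)%N ->
  [/\ bounded_desc (TT k) /\ simple (TT k),
      forall x, vertex P x -> x <> w ->
        vertex (TT k) x /\ forall i, (1 <= i <= k)%N -> ~~ tight (t i) x,
      forall a e, (1 <= a <= d)%N -> (1 <= e <= k)%N -> a != e ->
        exists x, sig k (phiB a e) (phiT a e) x,
      exists x, sig k (wB k) (wT k) x &
      forall x, vertex (TT k) x ->
        [\/ vertex P x /\ x <> w,
            exists a e, [/\ (1 <= a <= d)%N, (1 <= e <= k)%N, a != e &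
                           sig k (phiB a e) (phiT a e) x] |
            sig k (wB k) (wT k) x]].
Proof.
elim: k => [_|k IH kd].
  have T0 : TT 0 = P by rewrite /add_ineqs cats0.
  have s0 : sig 0 (wB 0) (wT 0) w.
    split; rewrite ?T0; [exact: silo_vertex_w|exact: silo_tight_w| |].
    - by move=> i hi; have [_ ->] := silo_b hi; rewrite /wB; lia.
    - by move=> i hi; lia.
  rewrite T0; split=> //.
  - by move=> x vx _; split=> // i hi; lia.
  - by move=> a e _ he; lia.
  - by exists w.
  - move=> x vx; have [->|ne] := pselect (x = w); first exact: Or33.
    exact: Or31.
have [[bk sk] hold hphi [wk sigk] hall] := IH (ltnW kd).
have [_ _ /(_ k kd)[wk' [hwk' trk]]] := silo.
(* The vertex truncated in the construction has the basis of the one given by induction, hence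
   equals it. *)
have ewk : wk' = wk by apply: vertex_with_basis_uniq hwk' (sig_w_basis (ltnW kd) sigk).
rewrite {}ewk {hwk'} in trk.
have [vwk hPk hbk htk] := sigk.
have bT i : (1 <= i <= d)%N -> b i \in TT k.
  by move=> hi; apply/mem_add_ineqs; left; have [] := silo_b hi.
have tT i : (1 <= i <= k)%N -> t i \in TT k.
  by move=> hi; apply/mem_add_ineqs; right; exists i.
have old x : vertex P x -> x <> w -> x <> wk.
  move=> vx nw; have [vx' nt] := hold x vx nw; move=> xw.
  case: (posnP k) => [k0|k0].
    by apply: nw; apply: sig_w0; rewrite xw; move: sigk; rewrite k0.
  have hk : (1 <= k <= k)%N by lia.
  by have := nt k hk; rewrite xw htk // /wT leqnn.
rewrite add_ineqsS; split.
- by split; [apply: truncation_bounded|apply: truncation_simple trk].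
- move=> x vx nw; have [vx' nt] := hold x vx nw.
  have [vx'' nt'] := old_vertex_truncation bk sk trk vx' (old x vx nw).
  split=> // i hi; have [->//|ni] := eqVneq i k.+1.
  by apply: nt; lia.
- move=> a e ha he ne; have [ek|ek] := eqVneq e k.+1; last first.
    have [x sx] := hphi a e ha ltac:(lia) ne.
    by exists x; apply: (phi_sig_step kd bk sk sigk trk) => //; lia.
  (* The vertices of the new row $k+1$ arise by dropping $b_a$ for $a>k+1$ and $t_a$ for $a\le
     k$. *)
  rewrite {}ek in he ne *; have [ak|ak] := ltnP k a.
    have [y vy dr] : exists2 y, vertex (TT k) y & drops (TT k) wk (b a) y.
      by apply: neighbor_exists => //; [apply: bT|rewrite hbk].
    by eexists; apply: (mid_sig_b kd sk sigk trk vy _ dr); lia.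
  have [y vy dr] : exists2 y, vertex (TT k) y & drops (TT k) wk (t a) y.
    by apply: neighbor_exists => //; [apply: tT; lia|rewrite htk /wT; lia].
  by eexists; apply: (mid_sig_t kd sk sigk trk vy _ dr); lia.
- have hk : (1 <= k.+1 <= d)%N by lia.
  have [y vy dr] : exists2 y, vertex (TT k) y & drops (TT k) wk (b k.+1) y.
    by apply: neighbor_exists => //; [apply: bT|rewrite hbk // /wB].
  by eexists; apply: (mid_sig_w kd sk sigk trk vy dr).
- move=> x /(truncation_vertex bk sk trk)[[vx nw]|[y wy ->]].
    case: (hall x vx) => [[vPx nPw]|[a [e [ha he ne sx]]]|sx].
    + exact: Or31.
    + apply: Or32; exists a, e; split=> //; first by lia.
      by apply: (phi_sig_step kd bk sk sigk trk).
    + by case: nw; apply: sig_uniq sx sigk.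
  have [_ vy _ _] := wy; have [c dr] := adjacent_drops sk wy; have [cT tc _ _] := dr.
  case: (sig_tight sigk cT tc) => -[a [ha h ca]]; rewrite {}ca in dr; last first.
    apply: Or32; exists a, k.+1; split=> //; [lia|lia|lia|].
    by apply: (mid_sig_t kd sk sigk trk vy _ dr); lia.
  have [ak|ak] := eqVneq a k.+1.
    by rewrite ak in dr; apply: Or33; apply: (mid_sig_w kd sk sigk trk vy dr).
  apply: Or32; exists a, k.+1; split=> //; first by lia.
  by apply: (mid_sig_b kd sk sigk trk vy _ dr); move: h; rewrite /wB; lia.
Qed.

End Silo.

(** * The graph of a silo *)

(* The silo is a bundle of d columns: sp k h is the vertex of column k at which
   exactly h of the new inequalities are tight (1 <= h <= d - 1), column k
   starts at the old neighbor sp k 0 = nb k, and all columns end at the peak.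
   The position pos k of column k tells which truncation does not meet it. *)
Record silo_structure (R : realType) (d : nat) (P : hdesc R d) (w : 'rV[R]_d)
    (nb : nat -> 'rV[R]_d) (S : hdesc R d) (pk : 'rV[R]_d)
    (pos : nat -> nat) (sp : nat -> nat -> 'rV[R]_d) : Prop := SiloStructure {
  ss_bounded : bounded_desc S;
  ss_simple : simple S;
  ss_peak : vertex S pk;
  ss_bottom : forall k, (1 <= k <= d)%N -> sp k 0%N = nb k;
  ss_column : forall k h, (1 <= k <= d)%N -> (h.+1 < d)%N ->
    adjacent S (sp k h) (sp k h.+1);
  ss_top : forall k, (1 <= k <= d)%N -> adjacent S (sp k d.-1) pk;
  ss_rung : forall k k', (1 <= k <= d)%N -> (1 <= k' <= d)%N -> k != k' ->
    ~~ [&& pos k == 1%N & pos k' == d] -> ~~ [&& pos k' == 1%N & pos k == d] ->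
    exists2 h, (1 <= h < d)%N & adjacent S (sp k h) (sp k' h);
  ss_vertex : forall x, vertex S x ->
    [\/ vertex P x /\ x <> w,
        exists k h, [/\ (1 <= k <= d)%N, (1 <= h < d)%N & x = sp k h] |
        x = pk];
  ss_old_vertex : forall x, vertex P x -> x <> w -> vertex S x;
  ss_old_adjacent : forall x y, x <> w -> y <> w -> adjacent P x y ->
    adjacent S x y;
  ss_old_neq : forall x, vertex P x -> x <> w -> x <> pk;
  ss_column_neq : forall k h, (1 <= k <= d)%N -> (1 <= h < d)%N -> sp k h <> pk;
  ss_lower : forall n x, vertex P x -> x <> w -> walk S n x pk ->
    exists2 m, walk P m x w & (m + d.-1 <= n)%N }.

Section SiloStructure.
Variables (R : realType) (d : nat) (P : hdesc R d) (w : 'rV[R]_d).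
Variables (b t : nat -> ineq R d) (nb : nat -> 'rV[R]_d).
Hypotheses (d2 : (2 <= d)%N) (bP : bounded_desc P) (sP : simple P).
Hypothesis (silo : siloing P w b t).
Hypothesis nbP : forall k, (1 <= k <= d)%N ->
  vertex P (nb k) /\ drops P w (b k) (nb k).
Implicit Types (x y z : 'rV[R]_d) (c : ineq R d) (B T : pred nat).

Local Notation S := (add_ineqs P t d).
Local Notation sigd := (sig P b t d).

Let inv := silo_invariant bP sP silo (leqnn d).

Let bS : bounded_desc S. Proof. by case: inv => -[]. Qed.
Let sS : simple S. Proof. by case: inv => -[]. Qed.
Let old x : vertex P x -> x <> w ->
  vertex S x /\ forall i, (1 <= i <= d)%N -> ~~ tight (t i) x.
Proof. by case: inv => _ h _ _ _; apply: h. Qed.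

Let nb_neq k : (1 <= k <= d)%N -> nb k <> w.
Proof. by move=> /nbP[_ /drops_neq ne] /esym. Qed.

Lemma sig_adjacent_b B T x y i0 : sigd B T x -> vertex S y ->
  (1 <= i0 <= d)%N -> B i0 -> ~~ tight (b i0) y ->
  (forall i, (1 <= i <= d)%N -> B i -> i != i0 -> tight (b i) y) ->
  (forall i, (1 <= i <= d)%N -> T i -> tight (t i) y) -> adjacent S x y.
Proof.
move=> sx vy hi0 Bi0 nt hB hT; have [vx _ hb ht] := sx.
apply: (@drops_adjacent _ _ _ _ (b i0)) => //; split=> //.
- by apply/mem_add_ineqs; left; have [] := silo_b silo hi0.
- by rewrite hb.
- move=> c cS tc nc; case: (sig_tight sx cS tc) => -[i [hi h ci]]; rewrite ci.
    by apply: hB => //; apply: contraNneq nc => ii0; rewrite ci ii0.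
  exact: hT.
Qed.

Lemma sig_adjacent_t B T x y i0 : sigd B T x -> vertex S y ->
  (1 <= i0 <= d)%N -> T i0 -> ~~ tight (t i0) y ->
  (forall i, (1 <= i <= d)%N -> B i -> tight (b i) y) ->
  (forall i, (1 <= i <= d)%N -> T i -> i != i0 -> tight (t i) y) -> adjacent S x y.
Proof.
move=> sx vy hi0 Ti0 nt hB hT; have [vx _ hb ht] := sx.
apply: (@drops_adjacent _ _ _ _ (t i0)) => //; split=> //.
- by apply/mem_add_ineqs; right; exists i0.
- by rewrite ht.
- move=> c cS tc nc; case: (sig_tight sx cS tc) => -[i [hi h ci]]; rewrite ci.
    exact: hB.
  by apply: hT => //; apply: contraNneq nc => ii0; rewrite ci ii0.
Qed.

(* The row (number of truncations performed) in which column k has height h: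
   column k skips row k. *)
Definition row_of k h := (h + (k <= h))%N.

Lemma sig_phi_adjacent e k k' x y : (1 <= k <= d)%N -> (1 <= k' <= d)%N ->
  k != k' -> (1 <= e <= d)%N -> e != k -> e != k' ->
  sigd (phiB k e) (phiT k e) x -> sigd (phiB k' e) (phiT k' e) y ->
  adjacent S x y.
Proof.
move=> hk hk' ne he nk nk' sx [vy _ hb ht]; have [lt|ge] := ltnP e k'.
  apply: (sig_adjacent_b (i0 := k') sx) => //.
  - by rewrite /phiB; lia.
  - by rewrite hb // /phiB eqxx andbF.
  - by move=> i hi; rewrite hb // /phiB; lia.
  - by move=> i hi; rewrite ht // /phiT; lia.
apply: (sig_adjacent_t (i0 := k') sx) => //.
- by rewrite /phiT; lia.
- by rewrite ht // /phiT eqxx andbF.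
- by move=> i hi; rewrite hb // /phiB; lia.
- by move=> i hi; rewrite ht // /phiT; lia.
Qed.

Let ht x := count (fun i => tight (t i) x) (iota 1 d).

(** An edge drops a single inequality, which is $t_i$ for at most one index because the $t_i$ are
    distinct. *)
Lemma height_adjacent x y : adjacent S x y -> (ht x <= (ht y).+1)%N.
Proof.
move=> /(adjacent_drops sS)[c [cS tx nty h]].
suff : (ht x <= ht y + count (fun i => t i == c) (iota 1 d))%N.
  move=> /leq_trans; apply; rewrite -[(ht y).+1]addn1 leq_add2l.
  have [[i hi /eqP ei]|hn] := pselect (exists2 i, i \in iota 1 d & t i == c); last first.
    rewrite (_ : count _ _ = 0%N) //; apply/eqP; rewrite -leqn0 leqNgt -has_count.
    by apply/hasP.
  move: hi; rewrite mem_iota => hi.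
  rewrite (@eq_in_count _ _ (pred1 i)).
    by rewrite count_uniq_mem ?iota_uniq // leq_b1.
  move=> j; rewrite mem_iota => hj /=; apply/eqP/eqP => [|-> //].
  by rewrite -ei => /(silo_t_inj silo); apply; lia.
pose A := predU (fun i => tight (t i) y) (fun i => t i == c).
rewrite /ht; apply: (@leq_trans (count A (iota 1 d))).
  have sub : {in iota 1 d, forall i, tight (t i) x -> tight (t i) y || (t i == c)}.
    move=> i; rewrite mem_iota => hi txi.
    have [->|ne] := eqVneq (t i) c; rewrite ?orbT //.
    rewrite h //; apply/mem_add_ineqs; right; exists i => //; lia.
  elim: (iota 1 d) sub => //= i s IH sub; apply: leq_add; last first.
    by apply: IH => j js; apply: sub; rewrite inE js orbT.
  by have := sub i (mem_head _ _); case: (tight (t i) x) => //= ->.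
by rewrite -count_predUI leq_addr.
Qed.

Lemma height_old x : vertex P x -> x <> w -> ht x = 0%N.
Proof.
move=> vx nw; have [_ nt] := old vx nw.
apply/eqP; rewrite -leqn0 leqNgt -has_count; apply/hasPn => i; rewrite mem_iota => hi.
by apply: nt; lia.
Qed.

Lemma height_peak x : sigd (wB d) (wT d) x -> ht x = d.
Proof.
move=> [_ _ _ h]; rewrite -[RHS](size_iota 1 d) /ht; apply/eqP; rewrite -all_count.
by apply/allP => i; rewrite mem_iota => hi; rewrite h /wT; lia.
Qed.

Lemma height_walk n x y : walk S n x y -> (ht y <= ht x + n)%N.
Proof.
elim: n x => [|n IH] x /=; first by move=> ->; rewrite addn0.
move=> [z [/adjacent_sym/height_adjacent xz /IH]]; lia.
Qed.

Lemma old_adjacent x y : x <> w -> y <> w -> adjacent P x y -> adjacent S x y.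
Proof.
move=> xw yw xy; have [vx vy _ _] := xy; have [c [cP tx nty h]] := adjacent_drops sP xy.
have [vx' nx] := old vx xw; have [vy' ny] := old vy yw.
apply: (@drops_adjacent _ _ _ _ c) => //; split=> //.
  by apply/mem_add_ineqs; left.
move=> c' /mem_add_ineqs[c'P|[i hi ->]]; first exact: h.
by rewrite (negPf (nx i hi)).
Qed.

Lemma adjacent_old x y : vertex P x -> x <> w -> vertex P y -> y <> w ->
  adjacent S x y -> adjacent P x y.
Proof.
move=> vx xw vy yw /(adjacent_drops sS)[c [cS tx nty h]].
have [_ nx] := old vx xw; apply: (@drops_adjacent _ _ _ _ c) => //; split=> //.
  by move/mem_add_ineqs: cS => [//|[i hi ci]]; rewrite ci (negPf (nx i hi)) in tx.
by move=> c' c'P; apply: h; apply/mem_add_ineqs; left.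
Qed.

(* An edge leaving the silo starts at a vertex with a single tight t_i, whose
   other tight inequalities come from w. *)
Lemma adjacent_silo_old x z : vertex P x -> x <> w -> adjacent S x z ->
  ~ (vertex P z /\ z <> w) -> adjacent P x w.
Proof.
move=> vx xw /adjacent_sym xz nz; have [vz _ _ _] := xz.
have [_ nx] := old vx xw; have [c [cS tz ntx h]] := adjacent_drops sS xz.
have tc i : (1 <= i <= d)%N -> tight (t i) z -> t i = c.
  move=> hi tiz; apply: contraTeq (nx i hi) => nc; rewrite negbK.
  by apply: h => //; apply/mem_add_ineqs; right; exists i.
have [_ _ _ _ /(_ z vz)] := inv.
move=> [//|[a [e [ha he ne [_ _ hb ht']]]]|[_ _ _ ht']]; last first.
  (* At the peak all $t_i$ are tight, while only one may be lost on an edge to an old vertex; since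
     $d\ge 2$ this is impossible. *)
  have h12 : 1%N = 2%N; last by [].
  have tcw i : (1 <= i <= d)%N -> t i = c.
    by move=> hi; apply: tc; rewrite // ht' /wT; lia.
  by apply: (silo_t_inj silo); [lia|lia|]; rewrite (tcw 1%N) ?(tcw 2%N) //; lia.
have te : t e = c by apply: tc => //; rewrite ht' /phiT //; lia.
(* For $i<e$ the inequality $t_i$ would be tight beside $t_e$, so every $b_i$ with $i\ne a$ is tight
   at [z]; it remains tight at [x], since the edge loses $t_e$. *)
have hbx i : (1 <= i <= d)%N -> i != a -> tight (b i) x.
  move=> hi ia; have biS : b i \in S.
    by apply/mem_add_ineqs; left; have [] := silo_b silo hi.
  apply: h => //.
    rewrite hb // /phiB ia andbT leqNgt; apply/negP => lt.
    have ei : e = i; last by lia.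
    apply: (silo_t_inj silo) => //; rewrite te; apply/esym/tc => //.
    by rewrite ht' // /phiT ia; lia.
  rewrite -te; apply: contraNneq (silo_t_notin silo he) => <-.
  by have [] := silo_b silo hi.
apply/adjacent_sym; have vw := silo_vertex_w silo.
apply: (@drops_adjacent _ _ _ _ (b a)) => //.
have [baP tba] := silo_b silo ha; split=> //.
  apply/negP => tax; apply: xw; apply: (vertex_determined vw) => c' c'P tw.
  have [i hi ->] := silo_tight_w silo c'P tw.
  by have [->//|ia] := eqVneq i a; apply: hbx.
move=> c' c'P tw nc; have [i hi ci] := silo_tight_w silo c'P tw; rewrite ci.
by apply: hbx => //; apply: contraNneq nc => <-; rewrite ci.
Qed.

Lemma silo_structure_exists : exists pk sp,
  [/\ silo_structure P w nb S pk id sp, is_peak P t pk &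
      forall k, (1 <= k <= d)%N ->
        is_phi P b t k (if k == d then d.-1 else d) (sp k d.-1)].
Proof.
have [_ _ hphi [pk spk] hall] := inv.
have [vpk _ hbpk htpk] := spk.
have /choice[f hf] : forall kh : nat * nat, exists x,
    (1 <= kh.1 <= d)%N -> (1 <= kh.2 < d)%N ->
    sigd (phiB kh.1 (row_of kh.1 kh.2)) (phiT kh.1 (row_of kh.1 kh.2)) x.
  move=> [k h] /=; have [hk|] := boolP ((1 <= k <= d)%N && (1 <= h < d)%N); last first.
    by move=> n; exists 0 => h1 h2; rewrite h1 h2 in n.
  have [|||x hx] := hphi k (row_of k h); [lia|rewrite /row_of; lia..|].
  by exists x.
pose sp k h := if h is 0%N then nb k else f (k, h).
have spP k h : (1 <= k <= d)%N -> (1 <= h < d)%N ->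
    sigd (phiB k (row_of k h)) (phiT k (row_of k h)) (sp k h).
  by case: h => [|h] hk hh; [lia|apply: (hf (k, h.+1))].
have rowP k h : (1 <= k <= d)%N -> (1 <= h < d)%N ->
    (1 <= row_of k h <= d)%N /\ row_of k h != k by rewrite /row_of; lia.
exists pk, sp; split; [|exact: (sig_peak silo spk)|]; last first.
- move=> k hk; have hd : (1 <= d.-1 < d)%N by lia.
  have := spP k d.-1 hk hd; have [r1 r2] := rowP k d.-1 hk hd.
  have -> : row_of k d.-1 = if k == d then d.-1 else d by rewrite /row_of; case: eqP; lia.
  by case: eqP => e; apply: (sig_phi_basis silo); lia.
split=> //.
- move=> k [|h] hk hh.
    have vn : vertex S (nb k) by have [v _] := nbP hk; have [] := old v (nb_neq hk).
    apply/adjacent_sym; have h1 : (1 <= 1 < d)%N by lia.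
    have [r1 r2] := rowP k 1%N hk h1.
    have [v [_ _ _ hd]] := nbP hk; have [_ nt] := old v (nb_neq hk).
    (* The bottom edge drops the only new inequality tight at height one. *)
    apply: (sig_adjacent_t (i0 := row_of k 1) (spP k 1%N hk h1) vn r1).
    + by rewrite /phiT; lia.
    + exact: nt.
    + move=> i hi /andP[_ ik]; have [biP tbi] := silo_b silo hi.
      by apply: hd => //; apply: contra ik => /eqP/(silo_b_inj silo hi hk) ->.
    + by move=> i hi; rewrite /phiT /row_of; lia.
  have hh1 : (1 <= h.+1 < d)%N by lia.
  have hh2 : (1 <= h.+2 < d)%N by lia.
  have [r1 r2] := rowP k h.+1 hk hh1.
  have [vy _ hb' ht'] := spP k h.+2 hk hh2.
  (* Going up from row $e$ drops $b_e$, because the bases of later rows contain no $b_i$ with $i\le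
     e$. *)
  apply: (sig_adjacent_b (i0 := row_of k h.+1) (spP k h.+1 hk hh1) vy r1).
  + by rewrite /phiB; lia.
  + by rewrite hb' // /phiB /row_of; lia.
  + by move=> i hi; rewrite hb' // /phiB /row_of; lia.
  + by move=> i hi; rewrite ht' // /phiT /row_of; lia.
- move=> k hk; have hd : (1 <= d.-1 < d)%N by lia.
  have [r1 r2] := rowP k d.-1 hk hd.
  apply: (sig_adjacent_b (i0 := row_of k d.-1) (spP k d.-1 hk hd) vpk r1).
  + by rewrite /phiB; lia.
  + by rewrite hbpk // /wB /row_of; lia.
  + by move=> i hi; rewrite hbpk // /wB /phiB /row_of; lia.
  + by move=> i hi; rewrite htpk // /wT; lia.
- move=> k k' hk hk' ne n1 n2.
  (* Vertices of a common row are adjacent. If neither column is 1, both have height 1 in row 1;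
     otherwise neither is $d$, and both have height $d-1$ in row $d$. *)
  have [h hh er] : exists2 h, (1 <= h < d)%N & row_of k h = row_of k' h.
    have [k1|k1] := boolP ((k == 1%N) || (k' == 1%N)).
      by exists d.-1; rewrite /row_of; lia.
    by exists 1%N; rewrite /row_of; lia.
  exists h => //; have [r1 r2] := rowP k h hk hh; have [_ r3] := rowP k' h hk' hh.
  have s1 := spP k h hk hh; have s2 := spP k' h hk' hh.
  rewrite er in r1 r2 s1; exact: sig_phi_adjacent s1 s2.
- move=> x vx; have [|[a [e [ha he ne sx]]]|sx] := hall x vx; first exact: Or31.
    apply: Or32; exists a, (e - (a < e))%N.
    have hh : (1 <= e - (a < e) < d)%N by case: ltnP => /=; lia.
    split=> //; apply: sig_uniq sx _.
    by have := spP a _ ha hh; rewrite (_ : row_of a _ = e) // /row_of; lia.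
  by apply: Or33; apply: sig_uniq sx spk.
- by move=> x vx nw; have [] := old vx nw.
- exact: old_adjacent.
- by move=> x vx nw xpk; have := height_peak spk; rewrite -xpk (height_old vx nw); lia.
- move=> k h hk hh spk'; have [r1 r2] := rowP k h hk hh.
  have [_ _ hb' _] := spP k h hk hh.
  by have := hb' _ r1; rewrite spk' hbpk // /wB /phiB; lia.
- elim=> [|n IH] x vx nw wn.
    by have := height_walk wn; rewrite (height_old vx nw) (height_peak spk); lia.
  have := height_walk wn; rewrite (height_old vx nw) (height_peak spk) => dn.
  move: wn => /= [z [xz wz]].
  have [[vz nz]|nz] := pselect (vertex P z /\ z <> w).
    have [m wm le] := IH z vz nz wz; exists m.+1; last by lia.
    by exists z; split=> //; apply: adjacent_old.
  (* The walk enters the silo here, so [x] is a neighbor of [w]; climbing from height 0 to height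
     $d$ already costs $1+(d-1)$ steps. *)
  exists 1%N; last by lia.
  exact/walk1/(adjacent_silo_old vx nw xz nz).
Qed.

End SiloStructure.

(** * Stacked silos *)

Lemma cyc_bounds d z : (0 < d)%N -> (1 <= cyc d z <= d)%N.
Proof. rewrite /cyc; lia. Qed.

Lemma cyc_modulo d z : (0 < d)%N -> exists q : int, (cyc d z)%:Z = z + q * d%:Z.
Proof.
move=> d0; exists (- ((z - 1) %/ d)%Z); rewrite /cyc.
have := divz_eq (z - 1) d; have : (0 <= (z - 1) %% d)%Z by lia.
lia.
Qed.

Lemma cyc_unique d (z q : int) y : (1 <= y <= d)%N -> y%:Z = z + q * d%:Z ->
  cyc d z = y.
Proof.
move=> hy e; have d0 : (0 < d)%N by lia.
have := cyc_bounds z d0; have [q' e'] := cyc_modulo z d0 => hc.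
have : (cyc d z)%:Z - y%:Z = (q' - q) * d%:Z by rewrite e e'; ring.
by have [|lt|->] := ltgtP q' q; nia.
Qed.

(** The place of the label [i] in the order used for the silo of step [j]; it inverts the reindexing
    of the basis in [cyclic_step]. *)
Definition pos d (j i : nat) : nat := cyc d (i%:Z - j%:Z + 1).

Lemma cyc_posK d (j i : nat) : (1 <= i <= d)%N ->
  cyc d (j%:Z + (pos d j i)%:Z - 1) = i.
Proof.
move=> hi; have d0 : (0 < d)%N by lia.
have [q e] := cyc_modulo (i%:Z - j%:Z + 1) d0.
by apply: (cyc_unique (q := - q)) => //; rewrite /pos e; ring.
Qed.

Lemma pos_cycK d (j k : nat) : (1 <= k <= d)%N ->
  pos d j (cyc d (j%:Z + k%:Z - 1)) = k.
Proof.
move=> hk; have d0 : (0 < d)%N by lia.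
have [q e] := cyc_modulo (j%:Z + k%:Z - 1) d0.
by apply: (cyc_unique (q := - q)) => //; rewrite e; ring.
Qed.

(** Identifies the exceptional neighbor of [cyclic_step] as the column in last position, which ends
    in row $d-1$ instead of row $d$. *)
Lemma pos_last d (j i : nat) : (1 <= i <= d)%N ->
  (pos d j i == d) = (i == cyc d (j%:Z - 1)).
Proof.
move=> hi; have d0 : (0 < d)%N by lia.
have [q e] := cyc_modulo (j%:Z - 1) d0.
apply/eqP/eqP => [pd|->]; last first.
  by apply: (cyc_unique (q := - q + 1)); [lia|rewrite e; ring].
have [q' e'] := cyc_modulo (i%:Z - j%:Z + 1) d0; rewrite -/(pos d j i) pd in e'.
by apply/esym/(cyc_unique (q := 1 - q')) => //; lia.
Qed.

(* Positions move back by one, cyclically, from one silo to the next, so that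
   columns at positions {1, d} get to positions {d, d - 1}. *)
Lemma pos_succ d (j i : nat) : (0 < d)%N ->
  pos d j.+1 i = (if pos d j i == 1%N then d else (pos d j i).-1).
Proof.
move=> d0; have := cyc_bounds (i%:Z - j%:Z + 1) d0.
have [q e] := cyc_modulo (i%:Z - j%:Z + 1) d0; rewrite -/(pos d j i) in e *.
move=> hp; case: eqP => p1.
  by apply: (cyc_unique (q := q + 1)); [lia|lia].
by apply: (cyc_unique (q := q)); [lia|lia].
Qed.

(** * From cyclic steps to columns *)

Lemma silo_structure_reindex (R : realType) (d : nat) (P S : hdesc R d) w pk nb sp
    (f g : nat -> nat) :
  (forall i, (1 <= i <= d)%N -> (1 <= f i <= d)%N /\ g (f i) = i) ->
  (forall k, (1 <= k <= d)%N -> (1 <= g k <= d)%N /\ f (g k) = k) ->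
  silo_structure P w nb S pk id sp ->
  silo_structure P w (nb \o f) S pk f (sp \o f).
Proof.
move=> hf hg [bS sS vpk bot col top rung vert oldv olda oldn coln low].
split=> //=.
- by move=> k hk; apply: bot; have [] := hf k hk.
- by move=> k h hk hh; apply: col => //; have [] := hf k hk.
- by move=> k hk; apply: top => //; have [] := hf k hk.
- move=> k k' hk hk' ne n1 n2; have [fk e] := hf k hk; have [fk' e'] := hf k' hk'.
  by apply: rung => //; apply: contra_neq ne => ff; rewrite -e -e' ff.
- move=> x /vert[|[k [h [hk hh xE]]]|]; [exact: Or31| |exact: Or33].
  by apply: Or32; exists (g k), h; have [gk gE] := hg k hk; rewrite gE.
- by move=> k h hk hh; apply: coln => //; have [] := hf k hk.
Qed.

(** The second conclusion is what allows stacking: the neighbors passed on to the next step are the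
    column tops, with unchanged labels. *)
Lemma cyclic_step_structure (R : realType) (d j : nat) (C C' : hdesc R d) w w' nb nb' :
  (2 <= d)%N -> bounded_desc C -> simple C ->
  (forall i, (1 <= i <= d)%N -> vertex C (nb i)) ->
  cyclic_step j C w nb C' w' nb' ->
  exists2 sp, silo_structure C w nb C' w' (pos d j) sp &
    forall i, (1 <= i <= d)%N -> nb' i = sp i d.-1.
Proof.
move=> d2 bC sC vnb [b [t /= [hT hb silo [-> hpk] hnb']]].
have d0 : (0 < d)%N by lia.
pose nbk (k : nat) := nb (cyc d (j%:Z + k%:Z - 1)).
have [|pk [sp [ss pkP phiP]]] := silo_structure_exists (nb := nbk) d2 bC sC silo.
  move=> k hk; rewrite /nbk; set i := cyc d _; have hi : (1 <= i <= d)%N by apply: cyc_bounds.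
  split; first exact: vnb.
  have : b i \in tight_ineqs C w by rewrite hT; apply: map_f; rewrite mem_iota; lia.
  rewrite mem_tight => /andP[tw bC']; have h := hb i hi; split=> //.
    apply/negP => tn; have := h (b i); by rewrite !mem_filter tw tn bC' eqxx.
  move=> c cC tc nc; have := h c; rewrite !mem_filter nc tc cC.
  by rewrite /= ?andbT => ->.
exists (fun i => sp (pos d j i)).
  have -> : w' = pk by apply: vertex_with_basis_uniq hpk pkP.
  have := @silo_structure_reindex _ _ _ _ _ _ _ _ (pos d j)
            (fun k => cyc d (j%:Z + k%:Z - 1)) _ _ ss.
  case.
  - by move=> i hi; split; [apply: cyc_bounds|apply: cyc_posK].
  - by move=> k hk; split; [apply: cyc_bounds|apply: pos_cycK].
  move=> bS sS vpk bot col top rung vert oldv olda oldn coln low; split=> //.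
  by move=> k hk; rewrite -[RHS](congr1 nb (cyc_posK j hk)); apply: bot.
move=> i hi; have := hnb' i hi; rewrite -pos_last //.
have := phiP (pos d j i) (cyc_bounds _ d0).
case: eqP => [->|_] h1 h2; exact: vertex_with_basis_uniq h2 h1.
Qed.

(* The result of stacking n silos on w: columns of height n (d - 1). *)
Record tower (R : realType) (d : nat) (P : hdesc R d) (w : 'rV[R]_d)
    (nb : nat -> 'rV[R]_d) (n : nat) (Q : hdesc R d) (pk : 'rV[R]_d)
    (col : nat -> nat -> 'rV[R]_d) : Prop := Tower {
  tw_bounded : bounded_desc Q;
  tw_simple : simple Q;
  tw_peak : vertex Q pk;
  tw_bottom : forall i, (1 <= i <= d)%N -> col i 0%N = nb i;
  tw_column : forall i h, (1 <= i <= d)%N -> (h < n * d.-1)%N ->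
    adjacent Q (col i h) (col i h.+1);
  tw_top : forall i, (1 <= i <= d)%N -> adjacent Q (col i (n * d.-1)%N) pk;
  tw_rung : forall j i i', (j < n)%N -> (1 <= i <= d)%N -> (1 <= i' <= d)%N ->
    i != i' -> ~~ [&& pos d j.+1 i == 1%N & pos d j.+1 i' == d] ->
    ~~ [&& pos d j.+1 i' == 1%N & pos d j.+1 i == d] ->
    exists2 h, (j * d.-1 < h <= j.+1 * d.-1)%N & adjacent Q (col i h) (col i' h);
  tw_vertex : forall x, vertex Q x ->
    [\/ vertex P x /\ x <> w,
        exists i h, [/\ (1 <= i <= d)%N, (1 <= h <= n * d.-1)%N & x = col i h] |
        x = pk];
  tw_old_vertex : forall x, vertex P x -> x <> w -> vertex Q x;
  tw_old_adjacent : forall x y, x <> w -> y <> w -> adjacent P x y ->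
    adjacent Q x y;
  tw_old_neq : forall x, vertex P x -> x <> w -> x <> pk;
  tw_column_neq : forall i h, (1 <= i <= d)%N -> (h <= n * d.-1)%N -> col i h <> pk;
  tw_lower : forall m x, vertex P x -> x <> w -> walk Q m x pk ->
    exists2 m', walk P m' x w & (m' + n * d.-1 <= m)%N }.

Section Tower.
Variables (R : realType) (d : nat) (P : hdesc R d) (w : 'rV[R]_d).
Variables (nb : nat -> 'rV[R]_d).
Hypothesis (d2 : (2 <= d)%N).

Lemma tower0 : bounded_desc P -> simple P -> vertex P w ->
  (forall i, (1 <= i <= d)%N -> adjacent P w (nb i)) ->
  tower P w nb 0 P w (fun i _ => nb i).
Proof.
move=> bP sP vw hnb; split=> //.
- by move=> i hi; apply/adjacent_sym/hnb.
- by move=> x vx; have [->|ne] := pselect (x = w); [apply: Or33|apply: Or31].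
- by move=> i h hi _ /esym; have [_ _] := hnb i hi.
- by move=> m x vx nw wm; exists m; rewrite // mul0n addn0.
Qed.

Lemma tower_column_vertex n Q pk col i h : tower P w nb n Q pk col ->
  (1 <= i <= d)%N -> (h <= n * d.-1)%N -> vertex Q (col i h).
Proof.
move=> tw hi; rewrite leq_eqVlt => /predU1P[->|lt].
  by have [] := tw_top tw hi.
by have [] := tw_column tw hi lt.
Qed.

(** The new silo replaces the peak and is glued to the column tops. All other vertices survive, and
    each silo adds $d-1$ to the lower bound. *)
Lemma towerS n Q pk col Q' pk' sp : tower P w nb n Q pk col ->
  silo_structure Q pk (fun i => col i (n * d.-1)%N) Q' pk' (pos d n.+1) sp ->
  tower P w nb n.+1 Q' pk'
    (fun i h => if (h <= n * d.-1)%N then col i h else sp i (h - n * d.-1)%N).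
Proof.
move=> tw [bS sS vpk bot cl top rung vert oldv olda oldn coln low].
have old i h : (1 <= i <= d)%N -> (h <= n * d.-1)%N ->
    vertex Q (col i h) /\ col i h <> pk.
  move=> hi hh.
  by split; [exact: tower_column_vertex tw hi hh|exact: (tw_column_neq tw hi hh)].
split=> //.
- by move=> i hi; rewrite leq0n (tw_bottom tw).
- move=> i h hi hh; case: ltnP => lt.
    rewrite (ltnW lt); apply: olda; [| |exact: (tw_column tw hi lt)].
    + by have [] := old i h hi (ltnW lt).
    + by have [] := old i h.+1 hi lt.
  (* At the seam $h=n(d-1)$ both definitions of the column agree, as a silo column starts at the old
     neighbor. *)
  rewrite (_ : (if _ then _ else _) = sp i (h - n * d.-1)%N).
    by rewrite subSn //; apply: cl => //; lia.
  case: leqP => le //; have -> : h = (n * d.-1)%N by apply/eqP; rewrite eqn_leq le.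
  by rewrite subnn bot.
- move=> i hi; rewrite mulSn (_ : (_ <= _)%N = false) ?addnK; last by lia.
  exact: top.
- move=> j i i' jn hi hi' ne n1 n2; move: jn; rewrite ltnS leq_eqVlt => /predU1P[jn|jn].
    rewrite {}jn in n1 n2 *; have [h hh adj] := rung i i' hi hi' ne n1 n2.
    exists (n * d.-1 + h)%N; first by rewrite mulSn; lia.
    by rewrite (_ : (_ <= _)%N = false) ?addKn //; lia.
  have [h hh adj] := tw_rung tw jn hi hi' ne n1 n2.
  have le : (h <= n * d.-1)%N.
    have : (j.+1 * d.-1 <= n * d.-1)%N by rewrite leq_mul2r jn orbT.
    by lia.
  exists h => //; rewrite le; apply: olda => //.
  + by have [] := old i h hi le.
  + by have [] := old i' h hi' le.
- move=> x /vert[[vx npk]|[i [h [hi hh ->]]]|]; last exact: Or33.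
    have [|[i [h [hi hh xE]]]|//] := tw_vertex tw vx; first exact: Or31.
    apply: Or32; exists i, h; rewrite mulSn; split=> //; first by lia.
    by have -> : (h <= n * d.-1)%N by lia.
  apply: Or32; exists i, (n * d.-1 + h)%N; rewrite mulSn; split=> //.
    by move: (n * d.-1)%N => K; lia.
  by rewrite (_ : (_ <= _)%N = false) ?addKn //; lia.
- move=> x vx nw.
  exact: (oldv _ (tw_old_vertex tw vx nw) (tw_old_neq tw vx nw)).
- move=> x y xw yw xy; have [vx vy _ _] := xy.
  apply: olda; [exact: (tw_old_neq tw vx xw)|exact: (tw_old_neq tw vy yw)|].
  exact: (tw_old_adjacent tw xw yw xy).
- move=> x vx nw.
  exact: (oldn _ (tw_old_vertex tw vx nw) (tw_old_neq tw vx nw)).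
- move=> i h hi hh; case: leqP => le; first by have [v ne] := old i h hi le; apply: oldn.
  by apply: coln => //; move: hh; rewrite mulSn; lia.
- move=> m x vx nw wm.
  have [m1 wm1 le1] := low m x (tw_old_vertex tw vx nw) (tw_old_neq tw vx nw) wm.
  have [m2 wm2 le2] := tw_lower tw vx nw wm1.
  by exists m2 => //; rewrite mulSn; lia.
Qed.

Lemma cyclic_siloing_tower r Q : bounded_desc P -> simple P ->
  cyclic_siloing r P w nb Q -> exists pk col, tower P w nb (r * d) Q pk col.
Proof.
move=> bP sP [C [ws [nbs [[C0 ws0 nbs0] [vw [_ hnb]] step ->]]]].
suff h j : (j <= r * d)%N -> exists2 col, tower P w nb j (C j) (ws j) col &
    forall i, (1 <= i <= d)%N -> nbs j i = col i (j * d.-1)%N.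
  by have [col tw _] := h _ (leqnn _); exists (ws (r * d)%N), col.
elim: j => [_|j IH jr].
  exists (fun i _ => nb i); last by rewrite nbs0.
  rewrite C0 ws0; apply: tower0 => // i hi; apply/hnb/map_f.
  by rewrite mem_iota; lia.
have [col tw hcol] := IH (ltnW jr).
have [|sp ss hsp] := cyclic_step_structure d2 (tw_bounded tw) (tw_simple tw) _
                       (step j.+1 jr).
  by move=> i hi; rewrite hcol //; apply: tower_column_vertex tw hi (leqnn _).
have ss' : silo_structure (C j) (ws j) (fun i => col i (j * d.-1)%N) (C j.+1)
    (ws j.+1) (pos d j.+1) sp.
  case: ss => bS sS vpk bot cl top rung vert oldv olda oldn coln low; split=> //.
  by move=> k hk; rewrite bot // hcol.
eexists; first exact: towerS tw ss'.
move=> i hi; rewrite hsp // mulSn (_ : (_ <= _)%N = false) ?addnK //.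
by lia.
Qed.

End Tower.

(** * Distances *)

Section Reach.
Variables (R : realType) (d : nat) (P : hdesc R d).
Implicit Types (x y z : 'rV[R]_d).

(** An upper bound on the distance: monotone in [n], it turns the combination of paths into
    arithmetic. *)
Definition reach n x y := exists2 m, (m <= n)%N & walk P m x y.

Lemma reach_walk n x y : walk P n x y -> reach n x y.
Proof. by exists n. Qed.

Lemma reach_adjacent x y : adjacent P x y -> reach 1 x y.
Proof. by move=> /walk1; apply: reach_walk. Qed.

Lemma reach_refl x : reach 0 x x.
Proof. exact: (@reach_walk 0). Qed.

Lemma reach_sym n x y : reach n x y -> reach n y x.
Proof. by move=> [m le /walk_sym]; exists m. Qed.

Lemma reach_cat m n x y z : reach m x y -> reach n y z -> reach (m + n) x z.
Proof.
move=> [m' le wm] [n' le' wn]; exists (m' + n')%N; first exact: leq_add.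
exact: walk_cat wm wn.
Qed.

Lemma reach_le m n x y : (m <= n)%N -> reach m x y -> reach n x y.
Proof. by move=> le [k le']; exists k => //; apply: leq_trans le. Qed.

End Reach.

Section TowerDistances.
Variables (R : realType) (d : nat) (P Q : hdesc R d) (w pk : 'rV[R]_d).
Variables (nb : nat -> 'rV[R]_d) (n : nat) (col : nat -> nat -> 'rV[R]_d).
Hypotheses (d3 : (3 <= d)%N) (n4 : (4 <= n)%N) (tw : tower P w nb n Q pk col).
Hypothesis nbP : forall x, adjacent P w x ->
  exists2 i, (1 <= i <= d)%N & x = nb i.
Implicit Types (x y z : 'rV[R]_d).

Local Notation K := (n * d.-1)%N.
(** The cost of changing columns from bottom to bottom: up and down at most $2(d-1)$ each, and one
    rung. *)
Local Notation L := (4 * d.-1 + 1)%N.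

Definition in_stack x :=
  (exists i h, [/\ (1 <= i <= d)%N, (1 <= h <= K)%N & x = col i h]) \/ x = pk.

Lemma column_reach_le i h h' : (1 <= i <= d)%N -> (h <= h' <= K)%N ->
  reach Q (h' - h) (col i h) (col i h').
Proof.
move=> hi /andP[le]; rewrite -{1 3}(subnKC le); elim: (h' - h)%N => [|k IH] hk.
  by rewrite addn0; apply: reach_refl.
rewrite -[X in reach _ X]addn1; apply: (reach_cat (IH _)); first by lia.
by rewrite addnS; apply/reach_adjacent/(tw_column tw hi); rewrite -addnS.
Qed.

Lemma column_reach i h h' : (1 <= i <= d)%N -> (h <= K)%N -> (h' <= K)%N ->
  reach Q ((h - h') + (h' - h)) (col i h) (col i h').
Proof.
move=> hi hh hh'; have [le|le] := leqP h h'.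
  apply: reach_le (column_reach_le hi (h := h) (h' := h') _); lia.
by apply/reach_sym/(reach_le _ (column_reach_le hi (h := h') (h' := h) _)); lia.
Qed.

Let K_ge : (2 * d.-1 <= K)%N.
Proof. by rewrite leq_mul2r; apply/orP; right; lia. Qed.

(* Among two consecutive silos, at least one has a rung between any two given
   columns; the two lowest silos are enough. *)
Lemma low_rung i i' : (1 <= i <= d)%N -> (1 <= i' <= d)%N ->
  exists2 g, (g <= 2 * d.-1)%N & reach Q 1 (col i g) (col i' g).
Proof.
move=> hi hi'; have [->|ne] := eqVneq i i'.
  by exists 0%N => //; apply: reach_le (reach_refl _ _).
have d0 : (0 < d)%N by lia.
have [bad|] := boolP ([&& pos d 1 i == 1%N & pos d 1 i' == d] ||
                      [&& pos d 1 i' == 1%N & pos d 1 i == d]); last first.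
  rewrite negb_or => /andP[n1 n2].
  have [|g hg adj] := tw_rung tw (j := 0) _ hi hi' ne n1 n2; first by lia.
  by exists g; [lia|apply: reach_adjacent].
(* The pair was at positions 1 and $d$, so it is now at $d$ and $d-1$, and $d\ge 3$ gives $d-1\ne
   1$. *)
have [|||g hg adj] := tw_rung tw (j := 1) _ hi hi' ne; first by lia.
- rewrite !(@pos_succ d 1) //.
  by case: (pos d 1 i =P 1%N) => e1; case: (pos d 1 i' =P 1%N) => e2; lia.
- rewrite !(@pos_succ d 1) //.
  by case: (pos d 1 i =P 1%N) => e1; case: (pos d 1 i' =P 1%N) => e2; lia.
by exists g; [lia|apply: reach_adjacent].
Qed.

Lemma column_switch c h i h' : (1 <= c <= d)%N -> (1 <= i <= d)%N ->
  (h <= K)%N -> (h' <= K)%N ->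
  exists2 g, (g <= 2 * d.-1)%N &
    reach Q ((h - g) + (g - h) + 1 + ((g - h') + (h' - g))) (col c h) (col i h').
Proof.
move=> hc hi hh hh'; have [g gl rg] := low_rung hc hi; exists g => //.
by apply: reach_cat (reach_cat (column_reach _ _ _) rg) (column_reach _ _ _) => //;
   apply: leq_trans K_ge.
Qed.

Lemma peak_column i h : (1 <= i <= d)%N -> (h <= K)%N ->
  reach Q (K - h + 1) (col i h) pk.
Proof.
move=> hi hh; apply: (reach_cat (column_reach_le hi (h' := K) _)); first by lia.
exact/reach_adjacent/(tw_top tw hi).
Qed.

Lemma stack_bottom x i : in_stack x -> (1 <= i <= d)%N ->
  reach Q (K + 1) x (nb i).
Proof.
move=> sx hi; rewrite -(tw_bottom tw hi).
case: sx => [[c [h [hc hh ->]]]|->]; last first.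
  by apply: reach_le (reach_sym (peak_column hi (leq0n _))); lia.
have [||g gl rg] := @column_switch c h i 0 hc hi; [lia|lia|].
(* From below the rung the path has length $2g-h+1\le 4(d-1)$ because $h\ge 1$; four silos make this
   at most $K$. From above it has length $h+1$. *)
apply: reach_le rg; have : (4 * d.-1 <= K)%N by rewrite leq_mul2r; apply/orP; right.
by lia.
Qed.

Lemma bottom_bottom i i' : (1 <= i <= d)%N -> (1 <= i' <= d)%N ->
  reach Q L (nb i) (nb i').
Proof.
move=> hi hi'; rewrite -(tw_bottom tw hi) -(tw_bottom tw hi').
have [||g gl rg] := @column_switch i 0 i' 0 hi hi'; [lia|lia|].
by apply: reach_le rg; lia.
Qed.

(* Either the bottom or the top of the tower provides a short enough detour. *)
Lemma stack_stack x y : in_stack x -> in_stack y -> reach Q (K + L) x y.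
Proof.
have pc i h : (1 <= i <= d)%N -> (1 <= h <= K)%N -> reach Q (K + L) (col i h) pk.
  by move=> hi hh; apply: reach_le (peak_column hi (h := h) _); lia.
move=> [[c [h [hc hh ->]]]|->] [[i [h' [hi hh' ->]]]|->].
- have [le|lt] := leqP (h + h') K.
    have [||g gl rg] := @column_switch c h i h' hc hi; [lia|lia|].
    by apply: reach_le rg; lia.
  have r1 := @peak_column c h hc ltac:(lia).
  have r2 := reach_sym (@peak_column i h' hi ltac:(lia)).
  by apply: reach_le (reach_cat r1 r2); lia.
- exact: pc.
- exact/reach_sym/pc.
- exact: reach_le (leq0n _) (reach_refl _ _).
Qed.

(** Cut just before its first visit to [w], the walk ends at a neighbor of [w] and survives in
    [Q]. *)
Lemma walk_to_w m x : x <> w -> walk P m x w ->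
  exists i, [/\ (1 <= i <= d)%N, (0 < m)%N & reach Q m.-1 x (nb i)].
Proof.
elim: m x => [|m IH] x nw //= [z [xz wz]].
have [zw|zw] := pselect (z = w).
  rewrite zw in xz; have [i hi xi] := nbP (adjacent_sym xz).
  by exists i; split=> //; rewrite -xi; apply: reach_le (leq0n _) (reach_refl _ _).
have [i [hi m0 ri]] := IH z zw wz; exists i; split=> //.
by apply: reach_le (reach_cat (reach_adjacent (tw_old_adjacent tw nw zw xz)) ri); lia.
Qed.

Lemma walk_avoid m x y : x <> w -> y <> w -> walk P m x y ->
  walk Q m x y \/
  exists m1 m2, [/\ (m1 + m2 = m)%N, walk P m1 x w & walk P m2 w y].
Proof.
elim: m x => [|m IH] x xw yw /=; first by left.
move=> [z [xz wz]]; have [zw|zw] := pselect (z = w).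
  right; exists 1%N, m; rewrite zw in xz wz; split=> //; exact: walk1.
case: (IH z zw yw wz) => [wQ|[m1 [m2 [e w1 w2]]]].
  by left; exists z; split=> //; apply: (tw_old_adjacent tw xw zw xz).
by right; exists m1.+1, m2; split=> //; [rewrite addSn e|exists z].
Qed.

(** A walk through [w] is rerouted between two of its neighbors along the bottom of the tower. *)
Lemma old_old m x y : x <> w -> y <> w -> walk P m x y -> reach Q (m + L) x y.
Proof.
move=> xw yw /(walk_avoid xw yw)[/reach_walk|[m1 [m2 [e w1 /walk_sym w2]]]].
  by apply: reach_le; lia.
have [i [hi m1p ri]] := walk_to_w xw w1; have [i' [hi' m2p ri']] := walk_to_w yw w2.
apply: reach_le (reach_cat (reach_cat ri (bottom_bottom hi hi')) (reach_sym ri')).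
by lia.
Qed.

(** Reaching a prescribed neighbor of [w] costs $K+1$ and the rest of the walk $m-1$, so the bound
    carries no extra term. The exact value of the diameter rests on this. *)
Lemma stack_old m x y : in_stack x -> y <> w -> walk P m w y ->
  reach Q (K + m) x y.
Proof.
move=> sx yw /walk_sym wm; have [i [hi mp ri]] := walk_to_w yw wm.
by apply: reach_le (reach_cat (stack_bottom sx hi) (reach_sym ri)); lia.
Qed.

Lemma tower_vertex_cases x : vertex Q x -> (vertex P x /\ x <> w) \/ in_stack x.
Proof.
move=> /(tw_vertex tw)[|h|->]; [by left|by right; left|by right; right].
Qed.

End TowerDistances.

(** * The diameter after siloing at both vertices *)

Theorem theorem3p11 (R : realType) (d : nat) (P : hdesc R d)
    (u v : 'rV[R]_d) (r : nat)
    (nbu nbv : nat -> 'rV[R]_d) (C Q : hdesc R d) :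
  (3 <= d)%N ->
  rational_desc P -> irredundant P -> polytope P -> simple P ->
  vertex P u -> vertex P v -> u <> v ->
  (maxn (diam P) 6 <= r)%N ->
  cyclic_siloing r P u nbu C ->
  cyclic_siloing r C v nbv Q ->
  diam Q = (dist P u v + 2 * r * d * (d - 1))%N.
Proof.
move=> d3 _ _ [bP _] sP vu vv uv; rewrite geq_max => /andP[rdiam r6] silC silQ.
have d2 : (2 <= d)%N by lia.
have nbuP x : adjacent P u x -> exists2 i, (1 <= i <= d)%N & x = nbu i.
  have [_ [_ [_ [_ [_ [_ h]] _ _]]]] := silC; move=> /h/mapP[i].
  by rewrite mem_iota => hi ->; exists i => //; lia.
have nbvP x : adjacent C v x -> exists2 i, (1 <= i <= d)%N & x = nbv i.
  have [_ [_ [_ [_ [_ [_ h]] _ _]]]] := silQ; move=> /h/mapP[i].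
  by rewrite mem_iota => hi ->; exists i => //; lia.
have [pu [colu twu]] := cyclic_siloing_tower d2 bP sP silC.
have [pv [colv twv]] := cyclic_siloing_tower d2 (tw_bounded twu) (tw_simple twu) silQ.
have n4 : (4 <= r * d)%N by nia.
set K := (r * d * d.-1)%N in twu twv *; set L := (4 * d.-1 + 1)%N.
have vu' : v <> u by move/esym.
have walkP x y : vertex P x -> vertex P y ->
    walk P (dist P x y) x y /\ (dist P x y <= r)%N.
  move=> vx vy; have [wxy _] := distP bP sP vx vy; split=> //.
  exact: leq_trans (dist_le_diam bP sP vx vy) rdiam.
(* The slack that absorbs a distance in $P$ together with one column change in each tower. *)
have bound : (r + 2 * L <= K)%N by rewrite /K /L; nia.
set D := dist P u v.
have reachC x y : vertex C x -> vertex C y -> reach C (K + r + L) x y.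
  move=> /(tower_vertex_cases twu)[[vx xu]|sx] /(tower_vertex_cases twu)[[vy yu]|sy].
  - have [wxy le] := walkP x y vx vy.
    by apply: reach_le (old_old d3 n4 twu nbuP xu yu wxy); lia.
  - have [wux le] := walkP u x vu vx.
    by apply: reach_sym; apply: reach_le (stack_old d3 n4 twu nbuP sy xu wux); lia.
  - have [wuy le] := walkP u y vu vy.
    by apply: reach_le (stack_old d3 n4 twu nbuP sx yu wuy); lia.
  - by apply: reach_le (stack_stack d3 n4 twu sx sy); lia.
(* Sharper than the general bound on $C$: the second siloing adds exactly $K$ to distances from $v$,
   so no error term is allowed here. *)
have reachv y : vertex C y -> reach C (K + D) v y.
  move=> /(tower_vertex_cases twu)[[vy yu]|sy].
    have [wvy le] := walkP v y vv vy.
    by apply: reach_le (old_old d3 n4 twu nbuP vu' yu wvy); lia.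
  have [wuv _] := walkP u v vu vv; apply: reach_sym.
  exact: (stack_old d3 n4 twu nbuP sy vu' wuv).
have reachQ x y : vertex Q x -> vertex Q y -> reach Q (D + 2 * K) x y.
  have mixed a b : in_stack pv (r * d) colv a -> vertex C b -> b <> v ->
      reach Q (D + 2 * K) a b.
    move=> sa vb bv; have [m le wm] := reachv b vb.
    by apply: reach_le (stack_old d3 n4 twv nbvP sa bv wm); lia.
  move=> /(tower_vertex_cases twv)[[vx xv]|sx] /(tower_vertex_cases twv)[[vy yv]|sy].
  - have [m le wm] := reachC x y vx vy.
    by apply: reach_le (old_old d3 n4 twv nbvP xv yv wm); lia.
  - exact/reach_sym/mixed.
  - exact: mixed.
  - by apply: reach_le (stack_stack d3 n4 twv sx sy); lia.
(* Contract the stack over $v$, reverse the walk, then contract the stack over $u$; each contraction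
   saves at least $K$. *)
have lower m : walk Q m pu pv -> (D + 2 * K <= m)%N.
  have puv : pu <> v by apply/nesym/(tw_old_neq twu vv vu').
  move=> wm; have [m1 w1 le1] := tw_lower twv (tw_peak twu) puv wm.
  have [m2 w2 le2] := tw_lower twu vv vu' (walk_sym w1).
  have [_ /(_ m2 (walk_sym w2))] := distP bP sP vu vv; rewrite -/D; lia.
have vpu : vertex Q pu.
  by apply: (tw_old_vertex twv (tw_peak twu)); apply/nesym/(tw_old_neq twu vv vu').
have vpv := tw_peak twv.
have -> : (D + 2 * r * d * (d - 1) = D + 2 * K)%N by rewrite /K subn1 !mulnA.
apply: diamE; split=> [x y vx vy|].
  have dxy := distP (tw_bounded twv) (tw_simple twv) vx vy.
  exists (dist Q x y); split=> //; have [m le wm] := reachQ x y vx vy.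
  by case: dxy => _ /(_ m wm) le'; apply: leq_trans le.
exists pu, pv; split=> //; have [m le wm] := reachQ pu pv vpu vpv.
split=> //; have := lower m wm => le'.
by have -> : (D + 2 * K = m)%N by apply/eqP; rewrite eqn_leq le le'.
Qed.
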